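(* Let $1\le m<n$ and let $\mu$ be an $\mathbb{F}_q$-labeled set partition of $\{1,2,\dots,m\}$. Then $$\mathrm{Ind}_{U_m}^{U_n}(\chi^\mu)=\chi^\mu *_1\chi^{\{m+1\}} *_1\chi^{\{m+2\}} *_1\cdots *_1\chi^{\{n\}},$$ where $\chi^\mu$ is the supercharacter of $U_m$ indexed by $\mu$, and the product on the right is evaluated from left to right, each operation $*_1\chi^{\{k\}}$ being extended linearly to linear combinations of supercharacters.
   Context: Groups. $U_n$ is the group of $n\times n$ unipotent upper-triangular matrices over the finite field $\mathbb{F}_q$, and $\mathfrak{n}_n=\{u-1\mid u\in U_n\}$. For $m\le n$, $U_m$ is embedded in $U_n$ as the matrices $u\in U_n$ with $u_{ij}=0$ whenever $i<j$ and $j>m$. Labeled set partitions. An $\mathbb{F}_q$-labeled set partition of a finite set $S$ of integers is a set partition of $S$ in which, for each pair $i<j$ of consecutive elements of a part (an arc $i\frown j$), a label in $\mathbb{F}_q^\times$ is chosen. Write $\mu_{ij}$ for the label of the arc $i\frown j$ of $\mu$, and $\mu_{ij}=0$ if $i\frown j$ is not an arc. Thus $\mu$ is determined by its ground set and a strictly upper-triangular array $(\mu_{ij})$ with at most one nonzero entry in every row and every column. Supercharacters. Fix a nontrivial homomorphism $\theta:\mathbb{F}_q^+\to\mathbb{C}^\times$. $U_n$ acts on both sides of the dual space $\mathfrak{n}_n^*$ by $(u\lambda v)(x-1)=\lambda(u^{-1}(x-1)v^{-1})$ for $\lambda\in\mathfrak{n}_n^*$, $u,v,x\in U_n$. For $\lambda\in\mathfrak{n}_n^*$,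 $$\chi^\lambda(u)=\frac{|U_n\lambda|}{|U_n\lambda U_n|}\sum_{\nu\in U_n(-\lambda)U_n}\theta\big(\nu(u-1)\big),\qquad u\in U_n.$$ A labeled set partition $\lambda$ of $\{1,\dots,n\}$ is identified with the functional $\lambda\in\mathfrak{n}_n^*$ with $\lambda(e_{ij})=\lambda_{ij}$ for $i<j$, where $e_{ij}$ is the matrix unit. The same definitions apply with any $m\geq1$ in place of $n$. The product $*_i$. For a labeled set partition $\mu$ and $i,k\in\mathbb{Z}_{\geq1}$ with $i\le k$, $\mu *_i\{k\}$ is the formal linear combination of labeled set partitions defined recursively, using the first applicable case, by $$\mu *_i\{k\}=\begin{cases} \mu\cup\{k\}, & \text{if } i=k,\\ q\,(\mu *_{i+1}\{k\}), & \text{if there is } l>k\text{ with }\mu_{il}\neq 0,\\ \mu\big|_{i\frown k\,\mapsto\, i\mid k} *_{i+1}\{k\}, & \text{if }\mu_{ik}\neq 0,\\ \mu *_{i+1}\{k\}+\sum_{t\in\mathbb{F}_q^\times}\mu\big|_{i\frown j\,\mapsto\, i\overset{t}{\frown}k} *_{i+1}\{j\}, & \text{if there is } j<k\text{ with }\mu_{ij}\neq 0,\\ \mu *_{i+1}\{k\}+\sum_{t\in\mathbb{F}_q^\times}\mu\big|_{i\mid\,\mapsto\, i\overset{t}{\frown}k}, & \text{otherwise.} \end{cases}$$ Here $\mu|_{i\frown k\mapsto i\mid k}$ deletes the arc $i\frown k$; $\mu|_{i\frown j\mapsto i\overset{t}{\frown}k}$ deletes the arc $i\frown j$ and adds the arc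 $i\frown k$ with label $t$; $\mu|_{i\mid\mapsto i\overset{t}{\frown}k}$ adds the arc $i\frown k$ with label $t$ (here $i$ is the last element of its part); all other arcs are unchanged. $\mu\cup\{k\}$ has the same arcs as $\mu$, with $k$ included in the ground set. In computing $\mu*_1\{k\}$ for $\mu$ a labeled set partition of $\{1,\dots,k-1\}$, all resulting labeled set partitions have ground set $\{1,\dots,k\}$. If $\mu *_i\{k\}=\sum_\lambda c_{\mu k}^\lambda\,\lambda$, then $\chi^\mu *_i\chi^{\{k\}}:=\sum_\lambda c_{\mu k}^\lambda\,\chi^\lambda$. For $\mu$ a labeled set partition of $\{1,\dots,k-1\}$, $\chi^\mu *_1\chi^{\{k\}}$ is a combination of supercharacters of $U_k$. *)

(* Defs.v *)
From HB Require Import structures.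
From mathcomp Require Import all_boot all_order all_fingroup all_algebra all_field.
From mathcomp Require Import all_character.
From mathcomp Require Import finmap.
From mathcomp Require Import freeg.

Set Implicit Arguments.
Unset Strict Implicit.
Unset Printing Implicit Defensive.

Import GRing.Theory.
Local Open Scope ring_scope.

Section Unitriangular.

Variables (F : finFieldType) (n : nat).

Definition is_unitri (A : 'M[F]_n) : bool :=
  [forall i, A i i == 1] && [forall i : 'I_n, forall j : 'I_n, (j < i)%N ==> (A i j == 0)].

Lemma is_unitriP (A : 'M[F]_n) :
  reflect ((forall i, A i i = 1) /\ (forall i j : 'I_n, (j < i)%N -> A i j = 0))
          (is_unitri A).
Proof.
apply: (iffP andP) => -[h1 h0]; split.
- by move=> i; apply/eqP; move/forallP: h1.
- by move=> i j ji; apply/eqP; move/forallP: h0 => /(_ i) /forallP /(_ j) /implyP; apply.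
- by apply/forallP=> i; rewrite h1.
- by apply/forallP=> i; apply/forallP=> j; apply/implyP=> ji; rewrite h0.
Qed.

Record unitri : predArgType := Unitri {unitri_mx :> 'M[F]_n; _ : is_unitri unitri_mx}.

HB.instance Definition _ := [isSub for unitri_mx].
HB.instance Definition _ := [Finite of unitri by <:].

Lemma unitri_diag (u : unitri) i : u i i = 1.
Proof. by case: u => A /= /is_unitriP[]. Qed.

Lemma unitri_low (u : unitri) (i j : 'I_n) : (j < i)%N -> u i j = 0.
Proof. by case: u => A /= /is_unitriP[_]; apply. Qed.

Fact unitri1_subproof : is_unitri 1%:M.
Proof.
apply/is_unitriP; split=> [i|i j ji]; rewrite mxE ?eqxx //.
by rewrite -val_eqE /= gtn_eqF.
Qed.

Definition unitri1 := Unitri unitri1_subproof.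

Fact unitriM_subproof (u v : unitri) : is_unitri (u *m v).
Proof.
apply/is_unitriP; split=> [i|i j ji]; rewrite mxE.
  rewrite (bigD1 i) //= !unitri_diag mulr1 big1 ?addr0 // => k.
  rewrite -val_eqE neq_ltn => /orP[] ki; first by rewrite unitri_low ?mul0r.
  by rewrite (unitri_low v) ?mulr0.
rewrite big1 // => k _; case: (ltnP k i) => ki; first by rewrite unitri_low ?mul0r.
by rewrite (unitri_low v) ?mulr0 // (leq_trans ji).
Qed.

Definition unitriM (u v : unitri) := Unitri (unitriM_subproof u v).

Fact unitriMA : associative unitriM.
Proof. by move=> u v w; apply: val_inj; rewrite /= mulmxA. Qed.

Fact unitri1M : left_id unitri1 unitriM.
Proof. by move=> u; apply: val_inj; rewrite /= mul1mx. Qed.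

Fact unitri_det (u : unitri) : \det u = 1.
Proof.
rewrite -det_tr det_trig; first by rewrite big1 // => i _; rewrite mxE unitri_diag.
by apply/is_trig_mxP => i j ij; rewrite mxE unitri_low.
Qed.

Fact unitri_unitmx (u : unitri) : (u : 'M_n) \in unitmx.
Proof. by rewrite unitmxE unitri_det unitr1. Qed.

Fact unitriV_subproof (u : unitri) : is_unitri (invmx u).
Proof.
have injM : injective (unitriM u).
  move=> v w /(congr1 val) /= e; apply: val_inj.
  by rewrite /= -[LHS](mulKmx (unitri_unitmx u)) e mulKmx ?unitri_unitmx.
suff -> : invmx u = invF injM unitri1 by case: (invF _ _).
have /(congr1 val) /= e := f_invF injM unitri1.
by rewrite -[RHS](mulKmx (unitri_unitmx u)) e mulmx1.
Qed.

Definition unitriV (u : unitri) := Unitri (unitriV_subproof u).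

Fact unitriVM : left_inverse unitri1 unitriV unitriM.
Proof. by move=> u; apply: val_inj; rewrite /= mulVmx ?unitri_unitmx. Qed.

HB.instance Definition _ := Finite_isGroup.Build unitri unitriMA unitri1M unitriVM.

(* The space n_n = {u - 1 | u in U_n} of strictly upper triangular matrices. *)
Definition strict_upper_pred : {pred 'M[F]_n} :=
  fun A => [forall i : 'I_n, forall j : 'I_n, (j <= i)%N ==> (A i j == 0)].
Definition strict_upper : qualifier 0 'M[F]_n := [qualify A | strict_upper_pred A].

Lemma strict_upperP (A : 'M[F]_n) :
  reflect (forall i j : 'I_n, (j <= i)%N -> A i j = 0) (A \is strict_upper).
Proof.
apply: (iffP forallP) => [h i j ji|h i].
  by apply/eqP; move: (h i) => /forallP /(_ j) /implyP; apply.
by apply/forallP=> j; apply/implyP=> ji; rewrite h.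
Qed.

Fact strict_upper_submod : submod_closed strict_upper.
Proof.
split=> [|a A B /strict_upperP hA /strict_upperP hB]; apply/strict_upperP=> i j ji.
  by rewrite mxE.
by rewrite !mxE hA // hB // mulr0 addr0.
Qed.

HB.instance Definition _ :=
  GRing.isSubmodClosed.Build F 'M[F]_n strict_upper_pred strict_upper_submod.

Record nilp : predArgType := Nilp {nilp_mx :> 'M[F]_n; _ : nilp_mx \is strict_upper}.

HB.instance Definition _ := [isSub for nilp_mx].
HB.instance Definition _ := [Finite of nilp by <:].
HB.instance Definition _ := [SubChoice_isSubZmodule of nilp by <:].
HB.instance Definition _ := [SubZmodule_isSubLmodule of nilp by <:].

Lemma nilp_low (x : nilp) (i j : 'I_n) : (j <= i)%N -> x i j = 0.
Proof. by case: x => A /= /strict_upperP; apply. Qed.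

Fact sub1_subproof (u : unitri) : (u : 'M_n) - 1%:M \is strict_upper.
Proof.
apply/strict_upperP=> i j; rewrite leq_eqVlt => /orP[/eqP/val_inj->|ji].
  by rewrite !mxE eqxx unitri_diag subrr.
by rewrite !mxE unitri_low // -val_eqE gtn_eqF // subrr.
Qed.

(* u - 1 *)
Definition sub1 (u : unitri) : nilp := Nilp (sub1_subproof u).

Fact nilp_mul_subproof (u v : unitri) (x : nilp) : u *m x *m v \is strict_upper.
Proof.
apply/strict_upperP=> i j ji; rewrite mxE big1 // => k _.
case: (leqP k j) => kj; last by rewrite (unitri_low v) ?mulr0.
rewrite mxE big1 ?mul0r // => l _.
case: (ltnP l i) => li; first by rewrite unitri_low ?mul0r.
by rewrite nilp_low ?mulr0 // (leq_trans kj) // (leq_trans ji).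
Qed.

Definition nilp_mul (u v : unitri) (x : nilp) : nilp := Nilp (nilp_mul_subproof u v x).

(* The dual space of n_n: linear forms on n_n. *)
Definition is_linear_form (f : {ffun nilp -> F}) : bool :=
  [forall a : F, forall x, forall y, f (a *: x + y) == a * f x + f y].

Lemma is_linear_formP (f : {ffun nilp -> F}) :
  reflect (forall a x y, f (a *: x + y) = a * f x + f y) (is_linear_form f).
Proof.
apply: (iffP idP) => [h a x y|h].
  by apply/eqP; move: h => /forallP /(_ a) /forallP /(_ x) /forallP /(_ y).
by apply/forallP=> a; apply/forallP=> x; apply/forallP=> y; rewrite h.
Qed.

Record dual : predArgType :=
  Dual {dual_fun : {ffun nilp -> F}; _ : is_linear_form dual_fun}.

HB.instance Definition _ := [isSub for dual_fun].
HB.instance Definition _ := [Finite of dual by <:].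

Definition dual_app (l : dual) : nilp -> F := dual_fun l.
Coercion dual_app : dual >-> Funclass.

Lemma dual_lin (l : dual) a x y : l (a *: x + y) = a * l x + l y.
Proof. exact: (elimT (is_linear_formP _) (valP l)). Qed.

Fact dual_opp_subproof (l : dual) : is_linear_form [ffun x => - l x].
Proof. by apply/is_linear_formP=> a x y; rewrite !ffunE dual_lin opprD mulrN. Qed.

Definition dual_opp (l : dual) : dual := Dual (dual_opp_subproof l).

Fact dual_act_subproof (u v : unitri) (l : dual) :
  is_linear_form [ffun x => l (nilp_mul u^-1%g v^-1%g x)].
Proof.
apply/is_linear_formP=> a x y; rewrite !ffunE -dual_lin; congr (l _).
by apply: val_inj; rewrite /= mulmxDr mulmxDl -scalemxAr -scalemxAl.
Qed.

(* u l v *)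
Definition dual_act (u : unitri) (l : dual) (v : unitri) : dual :=
  Dual (dual_act_subproof u v l).

Lemma dual_actE u l v x : dual_act u l v x = l (nilp_mul u^-1%g v^-1%g x).
Proof. exact: ffunE. Qed.

Lemma dual_actA u u' v v' l :
  dual_act u (dual_act u' l v') v = dual_act (u * u')%g l (v' * v)%g.
Proof.
apply: val_inj; apply/ffunP=> x; rewrite [LHS]dual_actE [RHS]dual_actE dual_actE.
by rewrite !invgM; congr (l _); apply: val_inj; rewrite /= !mulmxA.
Qed.

Definition left_orbit (l : dual) : {set dual} :=
  [set dual_act u l 1%g | u in [set: unitri]].

Definition two_sided_orbit (l : dual) : {set dual} :=
  [set dual_act u l v | u in [set: unitri], v in [set: unitri]].

Lemma two_sided_orbit_act u v l nu :
  nu \in two_sided_orbit l -> dual_act u nu v \in two_sided_orbit l.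
Proof. by case/imset2P=> u' v' _ _ ->; rewrite dual_actA; apply: imset2_f; rewrite inE. Qed.

Lemma dual_act1 l : dual_act 1%g l 1%g = l.
Proof.
apply: val_inj; apply/ffunP=> x; rewrite [LHS]dual_actE invg1; congr (l _).
by apply: val_inj; rewrite /= mul1mx mulmx1.
Qed.

Definition supercharacter_fun (theta : F -> algC) (l : dual) (u : unitri) : algC :=
  #|left_orbit l|%:R / #|two_sided_orbit l|%:R
    * \sum_(nu in two_sided_orbit (dual_opp l)) theta (nu (sub1 u)).

Fact supercharacter_subproof theta l :
  is_class_fun <<[set: unitri]>>%g [ffun u => supercharacter_fun theta l u].
Proof.
rewrite genGid; apply: intro_class_fun => [u v _ _|u]; last by rewrite inE.
congr (_ * _).
rewrite (reindex_onto (fun nu => dual_act v^-1%g nu v) (fun nu => dual_act v nu v^-1%g)) /=.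
  apply: eq_big => [nu|nu _].
    rewrite dual_actA mulgV dual_act1 eqxx andbT.
    apply/idP/idP => [/two_sided_orbit_act h|]; last exact: two_sided_orbit_act.
    by have := h v v^-1%g; rewrite dual_actA mulgV dual_act1.
  congr (theta _); rewrite dual_actE invgK; congr (nu _); apply: val_inj.
  rewrite /= mulmxBr mulmxBl mulmx1.
  rewrite !mulmxA !mulmxV ?unitri_unitmx // mul1mx.
  by rewrite -!mulmxA mulmxV ?unitri_unitmx // mulmx1.
by move=> nu _; rewrite dual_actA mulVg dual_act1.
Qed.

Definition supercharacter (theta : F -> algC) (l : dual) : 'CF([set: unitri]) :=
  Cfun 0 (supercharacter_subproof theta l).

End Unitriangular.

Section Embedding.

Variables (F : finFieldType) (m n : nat).
Hypothesis lemn : (m <= n)%N.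

(* The copy of U_m inside U_n. *)
Definition sub_unitri : {set unitri F n} :=
  [set u : unitri F n | [forall i : 'I_n, forall j : 'I_n,
             (i < j)%N && (m <= j)%N ==> (u i j == 0)]].

Lemma sub_unitriP (u : unitri F n) :
  reflect (forall i j : 'I_n, (i < j)%N -> (m <= j)%N -> u i j = 0) (u \in sub_unitri).
Proof.
rewrite inE; apply: (iffP idP) => [h i j ij mj|h].
  by apply/eqP; move: h => /forallP /(_ i) /forallP /(_ j) /implyP; apply; rewrite ij.
by apply/forallP=> i; apply/forallP=> j; apply/implyP=> /andP[ij mj]; rewrite h.
Qed.

Fact sub_unitri_group_set : group_set sub_unitri.
Proof.
apply/group_setP; split=> [|u v /sub_unitriP hu /sub_unitriP hv].
  by apply/sub_unitriP=> i j ij _; rewrite mxE -val_eqE ltn_eqF.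
apply/sub_unitriP=> i j ij mj; rewrite mxE big1 // => k _.
case: (ltngtP k j) => [kj|jk|/val_inj->].
- by rewrite hv ?mulr0.
- by rewrite hu ?mul0r ?(ltn_trans ij) // (leq_trans mj (ltnW jk)).
- by rewrite hu ?mul0r.
Qed.

Canonical sub_unitri_group := Group sub_unitri_group_set.

Definition embed_mx (A : 'M[F]_m) : 'M[F]_n :=
  \matrix_(i, j) if insub (val i) is Some i' then
                   if insub (val j) is Some j' then A i' j' else (i == j)%:R
                 else (i == j)%:R.

Lemma embed_mxE A (i j : 'I_m) :
  embed_mx A (widen_ord lemn i) (widen_ord lemn j) = A i j.
Proof. by rewrite mxE /= !valK. Qed.

Lemma embed_mx_out A (i j : 'I_n) :
  (m <= i)%N || (m <= j)%N -> embed_mx A i j = (i == j)%:R.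
Proof.
rewrite mxE; case: insubP => // i' im _; case: insubP => // j' jm _.
by rewrite (leqNgt m i) im (leqNgt m j) jm.
Qed.

Lemma embed_case (i : 'I_n) : (m <= i)%N \/ exists i' : 'I_m, i = widen_ord lemn i'.
Proof.
case: (leqP m i) => [|im]; first by left.
by right; exists (Ordinal im); apply: val_inj.
Qed.

Fact embed_subproof (u : unitri F m) : is_unitri (embed_mx u).
Proof.
apply/is_unitriP; split=> [i|i j ji].
  case: (embed_case i) => [mi|[i' ->]]; first by rewrite embed_mx_out ?mi // eqxx.
  by rewrite embed_mxE unitri_diag.
have ne : (i == j) = false by rewrite -val_eqE gtn_eqF.
case: (embed_case i) (embed_case j) => [mi _|[i' ei]]; first by rewrite embed_mx_out ?mi ?ne.
case=> [mj|[j' ej]]; first by rewrite embed_mx_out ?mj ?orbT ?ne.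
by rewrite ei ej embed_mxE unitri_low //; move: ji; rewrite ei ej.
Qed.

(* The embedding of U_m in U_n: u is extended by the identity matrix. *)
Definition embed (u : unitri F m) : unitri F n := Unitri (embed_subproof u).

Fact embedM : {in [set: unitri F m] &, {morph embed : u v / (u * v)%g}}.
Proof.
move=> u v _ _; apply: val_inj; apply/matrixP=> i j; rewrite [RHS]mxE /=.
case: (embed_case i) => [mi|[i' ->]].
  rewrite embed_mx_out ?mi // (bigD1 i) //= big1 => [|k ki].
    by rewrite !embed_mx_out ?mi ?eqxx // mul1r addr0.
  by rewrite embed_mx_out ?mi // eq_sym (negPf ki) mul0r.
case: (embed_case j) => [mj|[j' ->]].
  rewrite embed_mx_out ?mj ?orbT // (bigD1 j) //= big1 => [|k kj].
    by rewrite !embed_mx_out ?mj ?orbT ?eqxx // mulr1 addr0.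
  by rewrite (@embed_mx_out v) ?mj ?orbT // (negPf kj) mulr0.
rewrite embed_mxE mxE (bigID (fun k : 'I_n => (k < m)%N)) /= [X in _ + X]big1.
  rewrite addr0 (big_ord_narrow lemn) /=.
  by apply: eq_bigr => k _; rewrite !embed_mxE.
move=> k; rewrite -leqNgt => mk; rewrite (embed_mx_out u) ?mk ?orbT //.
by rewrite -val_eqE /= ltn_eqF ?mul0r // (leq_trans _ mk).
Qed.

Canonical embed_morphism := Morphism embedM.

Lemma embed_isom : isom [set: unitri F m] sub_unitri embed.
Proof.
apply/isomP; split.
  apply/injmP=> u v _ _ /(congr1 val) /= e; apply: val_inj; apply/matrixP=> i j.
  by rewrite -[LHS](embed_mxE u) -[RHS](embed_mxE v) e.
apply/setP=> w; apply/morphimP/sub_unitriP => [[u _ _ ->] i j ij mj|hw].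
  by rewrite /= embed_mx_out ?mj ?orbT // -val_eqE ltn_eqF.
have tU : is_unitri (\matrix_(i < m, j < m) w (widen_ord lemn i) (widen_ord lemn j)).
  by apply/is_unitriP; split=> [i|i j ji]; rewrite mxE ?unitri_diag ?unitri_low.
exists (Unitri tU); rewrite ?inE //; apply: val_inj; apply/matrixP=> i j /=.
have out : (m <= i)%N || (m <= j)%N -> w i j = (i == j)%:R.
  case: (ltngtP i j) => [ij|ji|/val_inj ->] mij; last by rewrite unitri_diag eqxx.
    rewrite -val_eqE ltn_eqF // hw //.
    by case/orP: mij => // mi; rewrite (leq_trans mi) // ltnW.
  by rewrite -val_eqE gtn_eqF // unitri_low.
case: (embed_case i) => [mi|[i' ei]]; first by rewrite embed_mx_out ?out ?mi.
case: (embed_case j) => [mj|[j' ej]]; first by rewrite embed_mx_out ?out ?mj ?orbT.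
by rewrite ei ej embed_mxE mxE.
Qed.

(* Ind_{U_m}^{U_n}, where a class function of U_m is first transported to the
   copy of U_m inside U_n. *)
Definition Ind_unitri (phi : 'CF([set: unitri F m])) : 'CF([set: unitri F n]) :=
  'Ind[[set: unitri F n], sub_unitri] (cfIsom embed_isom phi).

End Embedding.

Section LabeledSetPartitions.

Variable F : finFieldType.

(* A pair (S, (mu_ij)) of a ground set and an array of labels, the latter indexed by
   pairs of positive integers and finitely supported. Such data is a labeled set partition
   of S when is_labeled_set_partition S holds: mu_ij is then in F^* if i, j is an arc of
   the underlying set partition, and 0 otherwise. *)
Definition lsp : choiceType := ({fset nat} * {fsfun nat * nat -> F with 0})%type.

Implicit Types (mu : lsp) (i j k : nat) (t : F).

Definition ground mu : {fset nat} := mu.1.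
Definition label mu i j : F := mu.2 (i, j).

Definition set_partition (S : {fset nat}) (P : {fset {fset nat}}) : Prop :=
  [/\ fset0%fset \notin P, trivIfset P & fcover P = S].

(* i and j are consecutive elements of a part. *)
Definition is_arc (P : {fset {fset nat}}) i j : Prop :=
  exists B, [/\ B \in P, i \in B, j \in B, (i < j)%N
              & forall l, l \in B -> ~~ (i < l < j)%N].

Definition is_labeled_set_partition (S : {fset nat}) mu : Prop :=
  ground mu = S /\
  exists P, set_partition S P /\ forall i j, label mu i j != 0 <-> is_arc P i j.

(* Adding a point, or an arc ending at k, puts k in the ground set if it is not yet there. *)
Definition add_point k mu : lsp := ((k |` ground mu)%fset, mu.2).
Definition del_arc i j mu : lsp := (ground mu, [fsfun mu.2 with (i, j) |-> 0]).
Definition add_arc i k t mu : lsp := ((k |` ground mu)%fset, [fsfun mu.2 with (i, k) |-> t]).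

Definition has_arc_beyond i k mu : bool :=
  has (fun p => (p.1 == i) && (k < p.2)%N) (finsupp mu.2).

Lemma has_arc_beyondP i k mu :
  reflect (exists2 l, (k < l)%N & label mu i l != 0) (has_arc_beyond i k mu).
Proof.
apply: (iffP hasP) => [[[a l] /=]|[l kl il]].
  by rewrite mem_finsupp => h /andP[/eqP <- kl]; exists l.
by exists (i, l); rewrite /= ?eqxx // mem_finsupp.
Qed.

Local Notation lsp_comb := {freeg lsp / algC}.

Definition basis mu : lsp_comb := << mu >>.

(* The argument d bounds the recursion depth; d = k - i always suffices (see starE). *)
Fixpoint star_rec (d i k : nat) mu : lsp_comb :=
  if i == k then basis (add_point k mu) else
  if d is d'.+1 then
    if has_arc_beyond i k mu then #|F|%:R *: star_rec d' i.+1 k mu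
    else if label mu i k != 0 then star_rec d' i.+1 k (del_arc i k mu)
    else if [pick j : 'I_k | (i < j)%N && (label mu i j != 0)] is Some j then
      star_rec d' i.+1 k mu +
      \sum_(t : F | t != 0) star_rec d' i.+1 j (add_arc i k t (del_arc i j mu))
    else star_rec d' i.+1 k mu + \sum_(t : F | t != 0) basis (add_arc i k t mu)
  else 0.

(* mu *_i {k}, for i <= k *)
Definition star i k mu : lsp_comb := star_rec (k - i) i k mu.

Lemma star_rec_fuel d i k mu : (i <= k)%N -> (k - i <= d)%N ->
  star_rec d i k mu = star i k mu.
Proof.
rewrite /star; move: {2 4}(k - i)%N (leqnn (k - i)) => e.
elim: d e i k mu => [|d IH] [|e] i k mu ke ik kd //=; case: eqP => // /eqP ne;
  have lt_ik : (i < k)%N by rewrite ltn_neqAle ne.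
- by move: kd; rewrite leqn0 subn_eq0 leqNgt lt_ik.
- by move: ke; rewrite leqn0 subn_eq0 leqNgt lt_ik.
have le1 : (k - i.+1 <= e)%N by rewrite subnS; case: (k - i)%N ke.
have le2 : (k - i.+1 <= d)%N by rewrite subnS; case: (k - i)%N kd.
have E nu : star_rec d i.+1 k nu = star_rec e i.+1 k nu by apply: IH.
rewrite !E; case: ifP => // _; case: ifP => // _; case: pickP => [j /andP[ij _]|_] //.
congr (_ + _); apply: eq_bigr => t _; apply: IH => //.
  by rewrite (leq_trans _ le1) // leq_sub2r // ltnW.
by rewrite (leq_trans _ le2) // leq_sub2r // ltnW.
Qed.

Lemma starE i k mu : (i <= k)%N ->
  star i k mu =
    if i == k then basis (add_point k mu)
    else if has_arc_beyond i k mu then #|F|%:R *: star i.+1 k mu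
    else if label mu i k != 0 then star i.+1 k (del_arc i k mu)
    else if [pick j : 'I_k | (i < j)%N && (label mu i j != 0)] is Some j then
      star i.+1 k mu + \sum_(t : F | t != 0) star i.+1 j (add_arc i k t (del_arc i j mu))
    else star i.+1 k mu + \sum_(t : F | t != 0) basis (add_arc i k t mu).
Proof.
move=> ik; rewrite {1}/star; case: eqP => [->|/eqP ne]; first by case: (k - k)%N => [|?] /=; rewrite eqxx.
have lt_ik : (i < k)%N by rewrite ltn_neqAle ne.
have -> : (k - i = (k - i.+1).+1)%N by rewrite -subSn.
rewrite /= (negPf ne).
case: ifP => // _; case: ifP => // _; case: pickP => [j /andP[ij _]|_] //.
congr (_ + _); apply: eq_bigr => t _; apply: star_rec_fuel => //.
by rewrite leq_sub2r // ltnW.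
Qed.

(* D *_i {k}: the linear extension of mu |-> mu *_i {k} *)
Definition star_comb i k (D : lsp_comb) : lsp_comb := fglift (star i k) D.

(* The functional on n_n with e_ij |-> mu_ij; see functional_of_delta. *)
Definition functional_of_fun n mu : {ffun nilp F n -> F} :=
  [ffun x : nilp F n => \sum_(i < n) \sum_(j < n | (i < j)%N) label mu i.+1 j.+1 * x i j].

Fact functional_of_subproof n mu : is_linear_form (functional_of_fun n mu).
Proof.
apply/is_linear_formP=> a x y; rewrite !ffunE mulr_sumr -big_split.
apply: eq_bigr => i _; rewrite mulr_sumr -big_split; apply: eq_bigr => j _ /=.
by rewrite !mxE mulrDr mulrCA.
Qed.

Definition functional_of n mu : dual F n := Dual (functional_of_subproof n mu).

Lemma functional_of_delta n mu (x : nilp F n) (i j : 'I_n) :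
  (i < j)%N -> nilp_mx x = delta_mx i j -> functional_of n mu x = label mu i.+1 j.+1.
Proof.
move=> ij ex; rewrite [LHS]ffunE (bigD1 i) //= (bigD1 j) //= ex mxE !eqxx mulr1.
rewrite big1 => [|l /andP[_ lj]]; last by rewrite mxE (negPf lj) andbF mulr0.
rewrite big1 ?addr0 // => k ki; rewrite big1 // => l _.
by rewrite mxE (negPf ki) mulr0.
Qed.

(* The supercharacter of U_n indexed by mu *)
Definition chi (theta : F -> algC) n mu : 'CF([set: unitri F n]) :=
  supercharacter theta (functional_of n mu).

(* The class function \sum_l c_l chi^l, for the formal linear combination \sum_l c_l l.
   Products *_i of supercharacters are computed on formal linear combinations and then
   evaluated by chi_comb. *)
Definition chi_comb (theta : F -> algC) n (D : lsp_comb) : 'CF([set: unitri F n]) :=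
  fglift (chi theta n) D.

End LabeledSetPartitions.

(* theta is a nontrivial homomorphism from the additive group of F to C^*. *)
Definition nontrivial_add_char (F : finFieldType) (theta : F -> algC) : Prop :=
  [/\ theta 0 = 1, forall a b, theta (a + b) = theta a * theta b
    & exists a, theta a != 1].

(* Main.v *)
Require Import Defs.
From mathcomp Require Import all_boot all_order all_fingroup all_algebra all_field.
From mathcomp Require Import all_character.
From mathcomp Require Import finmap.
From HB Require Import structures.
From mathcomp Require Import freeg.

(* Fix u in U_n and put N = u - 1. For row vectors r over F, let P(i, k) be the sum of
   theta((r N)_k) over the r supported on [i, k-1] with (r N)_b = 0 for all b < k, and
   let A(i, k, t) be the part of that sum with r_i = -t, so that
   P(i, k) = \sum_t A(i, k, t) and A(i, k, 0) = P(i+1, k).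

   Counting the g in U_n with u^g in U_m column by column shows that Ind_{U_m}^{U_n} 1
   takes the value \prod_(m < k <= n) P(1, k) at u. Averaging theta over the two-sided
   orbit, column by column and then row by row, shows that chi^mu(u) is the product of
   the A(i, k, mu_ik) over the arcs of mu. As chi^mu on U_m is the restriction of chi^mu
   on U_n, it remains to see that mu *_i {k} evaluates to chi^mu(u) P(i, k). Here
   P(i, k) = P(i+1, k) + \sum_(t != 0) A(i, k, t), and for t != 0 and j < k one has
   A(i, k, t) A(i, j, s) = A(i, k, t) P(i+1, j), because a vector of the first sum,
   truncated, can be used to clear the i-th entry in the second; this is exactly the
   recursion that defines *_i. *)

Set Implicit Arguments.
Unset Strict Implicit.
Unset Printing Implicit Defensive.

Import GRing.Theory Num.Theory.
Local Open Scope ring_scope.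

(** * Orbit sums and linear extension *)

(** The elements of [G] that carry [x] to a given point of its orbit form a coset of the
    stabilizer. *)
Lemma sum_act_orbit (R : pzSemiRingType) (aT : finGroupType) (T : finType)
    (to : {action aT &-> T}) (G : {group aT}) (x : T) (f : T -> R) :
  \sum_(a in G) f (to x a) = #|('C_G[x | to])%g|%:R * \sum_(y in orbit to G x) f y.
Proof.
rewrite (partition_big (to x) (mem (orbit to G x))) => [|a Ga]; last exact: mem_orbit.
rewrite mulr_sumr; apply: eq_bigr => _ /orbitP[a Ga <-].
rewrite (eq_bigr (fun=> f (to x a))) => [|b /andP[_ /eqP ->]] //.
rewrite sumr_const mulr_natl; congr (_ *+ _).
rewrite -(card_rcoset _ a) -(amove_act to x (subsetT G) Ga); apply: eq_card => b.
by rewrite !inE.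
Qed.

Lemma fglift_linear (R : nzRingType) (K : choiceType) (M : lmodType R) (f : K -> M) :
  linear (fglift f : {freeg K / R} -> M).
Proof.
have addf : additive (fglift f : {freeg K / R} -> M) := lift_is_additive f.
pose g : {additive {freeg K / R} -> M} := HB.pack (fglift f) (GRing.isAdditive.Build _ _ _ addf).
move=> a x y; rewrite -[fglift f]/(g : _ -> _) raddfD; congr (_ + _).
rewrite -[x in RHS]freeg_sumE [a *: x]/(fgscale a x) /fgscale !(raddf_sum g).
by rewrite scaler_sumr; apply: eq_bigr => z _ /=; rewrite !liftU scalerA.
Qed.

(** * Sums of additive characters *)

Section AdditiveCharacter.

Variables (F : finFieldType) (theta : F -> algC).
Hypothesis htheta : nontrivial_add_char theta.

Local Notation q := (#|F|%:R : algC).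

Lemma card_fin_neq0 : q != 0.
Proof. by rewrite pnatr_eq0 -lt0n; apply/card_gt0P; exists 0. Qed.

Lemma theta_sum (I : finType) (P : pred I) (f : I -> F) :
  theta (\sum_(i | P i) f i) = \prod_(i | P i) theta (f i).
Proof. by case: htheta => t0 tD _; apply: (big_morph theta tD t0). Qed.

(** If [w] is nonzero, shifting [x] by [a / w] multiplies the sum by [theta a]; choosing [a] with
    [theta a != 1] forces the sum to vanish. *)
Lemma sum_theta (w : F) : \sum_x theta (w * x) = if w == 0 then q else 0.
Proof.
case: htheta => t0 tD [a ta]; case: eqP => [->|/eqP w0].
  rewrite (eq_bigr (fun=> 1)) => [|x _]; last by rewrite mul0r.
  by rewrite sumr_const.
apply: (mulfI (_ : theta a - 1 != 0)); first by rewrite subr_eq0.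
rewrite mulr0 mulrBl mul1r; apply/eqP; rewrite subr_eq0; apply/eqP.
rewrite mulr_sumr [RHS](reindex_inj (addrI (a / w))) /=; apply: eq_bigr => x _.
by rewrite mulrDr tD mulrC [w * (_ / _)]mulrC divfK // mulrC.
Qed.

(** Distributivity. With all [f a x] equal to 1 it counts the vectors subject to one condition per
    coordinate. *)
Lemma sum_ffun_coord (n : nat) (Q : 'I_n -> pred F) (f : 'I_n -> F -> algC) :
  \sum_(r : {ffun 'I_n -> F} | [forall a, Q a (r a)]) \prod_a f a (r a) =
  \prod_a \sum_(x | Q a x) f a x.
Proof.
rewrite bigA_distr_big_dep; apply: eq_bigl => r.
by apply/forallP/familyP.
Qed.

Definition row_ok n (i : 'I_n) (r : {ffun 'I_n -> F}) : bool :=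
  [forall a : 'I_n, if a == i then r a == 1 else (a < i)%N ==> (r a == 0)].

Definition col_ok n (i : 'I_n) (r : {ffun 'I_n -> F}) : bool :=
  [forall a : 'I_n, if a == i then r a == 1 else (i < a)%N ==> (r a == 0)].

Definition row_of n (g : 'M[F]_n) i := [ffun a => g i a].
Definition col_of n (g : 'M[F]_n) i := [ffun a => g a i].

(** The rows of a unitriangular matrix can be chosen independently of each other. *)
Lemma sum_rows n (f : 'I_n -> {ffun 'I_n -> F} -> algC) :
  \sum_(g : unitri F n) \prod_i f i (row_of g i) =
  \prod_i \sum_(r | row_ok i r) f i r.
Proof.
rewrite bigA_distr_big_dep.
(* The default [unitri1] of [insubd] is never taken: a family of admissible rows always gives a
   unitriangular matrix. *)
rewrite (reindex_onto (fun g : unitri F n => [ffun i => row_of g i])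
  (fun r : {ffun 'I_n -> {ffun 'I_n -> F}} =>
     insubd (unitri1 F n) (\matrix_(i, j) r i j))) /=.
  apply: eq_big => [g|g _]; last by apply: eq_bigr => i _; rewrite ffunE.
  apply/esym/andP; split.
    apply/familyP => i; apply/forallP => a; rewrite !ffunE.
    case: eqP => [->|_]; first by rewrite unitri_diag.
    by apply/implyP => ai; rewrite unitri_low.
  apply/eqP; rewrite -[RHS](valKd (unitri1 F n)); congr (insubd _ _).
  by apply/matrixP => i j; rewrite !mxE !ffunE.
move=> r /familyP rok; apply/ffunP => i; apply/ffunP => j.
rewrite !ffunE val_insubd; case: ifP => [_|/negP[]]; first by rewrite mxE.
apply/is_unitriP; split => [a|a b ba].
  by have /forallP/(_ a) := rok a; rewrite eqxx mxE => /eqP.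
have /forallP/(_ b) := rok a; rewrite -val_eqE ltn_eqF // mxE ba /=.
by move/eqP.
Qed.

Lemma sum_cols n (f : 'I_n -> {ffun 'I_n -> F} -> algC) :
  \sum_(g : unitri F n) \prod_i f i (col_of g i) =
  \prod_i \sum_(r | col_ok i r) f i r.
Proof.
rewrite bigA_distr_big_dep.
rewrite (reindex_onto (fun g : unitri F n => [ffun i => col_of g i])
  (fun r : {ffun 'I_n -> {ffun 'I_n -> F}} =>
     insubd (unitri1 F n) (\matrix_(i, j) r j i))) /=.
  apply: eq_big => [g|g _]; last by apply: eq_bigr => i _; rewrite ffunE.
  apply/esym/andP; split.
    apply/familyP => i; apply/forallP => a; rewrite !ffunE.
    case: eqP => [->|_]; first by rewrite unitri_diag.
    by apply/implyP => ai; rewrite unitri_low.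
  apply/eqP; rewrite -[RHS](valKd (unitri1 F n)); congr (insubd _ _).
  by apply/matrixP => i j; rewrite !mxE !ffunE.
move=> r /familyP rok; apply/ffunP => i; apply/ffunP => j.
rewrite !ffunE val_insubd; case: ifP => [_|/negP[]]; first by rewrite mxE.
apply/is_unitriP; split => [a|a b ba].
  by have /forallP/(_ a) := rok a; rewrite eqxx mxE => /eqP.
have /forallP/(_ a) := rok b; rewrite -val_eqE gtn_eqF // mxE ba /=.
by move/eqP.
Qed.

Lemma prod_leq_card n (k : nat) : (k <= n)%N ->
  \prod_(a < n) (if (a < k)%N then q else 1) = q ^+ k.
Proof.
by move=> kn; rewrite -big_mkcond (big_ord_narrow kn) prodr_const card_ord.
Qed.

(** Each of the [k] free coordinates [b < k] contributes a full character sum, that is [q] or 0;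
    coordinate [k] is 1 and the later ones are 0. *)
Lemma sum_col_theta n (k : 'I_n) (w : 'I_n -> F) :
  \sum_(c | col_ok k c) theta (\sum_b w b * c b) =
  if [forall b : 'I_n, (b < k)%N ==> (w b == 0)] then q ^+ k * theta (w k) else 0.
Proof.
have [t0 _ _] := htheta.
under eq_bigr do rewrite theta_sum.
rewrite (@sum_ffun_coord n
  (fun a x => if a == k then x == 1 else (k < a)%N ==> (x == 0))
  (fun b x => theta (w b * x))) /=.
have E b : \sum_(x | if b == k then x == 1 else (k < b)%N ==> (x == 0)) theta (w b * x) =
   (if (b < k)%N then (if w b == 0 then q else 0) else 1) *
   (if b == k then theta (w k) else 1).
  case: (ltngtP b k) => [bk|kb|/val_inj ->].
  - by rewrite -val_eqE ltn_eqF //= mulr1 -sum_theta.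
  - by rewrite -val_eqE gtn_eqF //= (big_pred1 0) // mulr0 mulr1 t0.
  - by rewrite eqxx mul1r (big_pred1 1) // mulr1.
under eq_bigr do rewrite E.
rewrite big_split /= -[X in _ * X]big_mkcond big_pred1_eq /=.
case: ifP => [/forallP w0|].
  rewrite -(prod_leq_card (ltnW (ltn_ord k))); congr (_ * _); apply: eq_bigr => b _.
  by case: ifP => // bk; have := w0 b; rewrite bk /= => ->.
move/negbT; rewrite negb_forall => /existsP[b]; rewrite negb_imply => /andP[bk wb].
by rewrite (bigD1 b) //= bk (negPf wb) !mul0r.
Qed.

End AdditiveCharacter.

(** * The recursion defining the product *)

Section ArcSums.

Variables (F : finFieldType) (theta : F -> algC).
Hypothesis htheta : nontrivial_add_char theta.
Variables (n : nat) (u : unitri F n).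

Local Notation q := (#|F|%:R : algC).
Local Notation vec := {ffun 'I_n -> F}.
Implicit Types (r : vec) (i j k l : nat) (s t : F) (la mu : lsp F).

Definition mul_sub1 r (b : 'I_n) : F := \sum_a r a * sub1 u a b.

Lemma mul_sub1D c r r' b :
  mul_sub1 [ffun a => r a + c * r' a] b = mul_sub1 r b + c * mul_sub1 r' b.
Proof.
rewrite /mul_sub1 mulr_sumr -big_split; apply: eq_bigr => a _ /=.
by rewrite ffunE mulrDl mulrA.
Qed.

(** From here on [i] and [k] are numbered from 1, like the labels, while ordinals start at 0; hence
    the successors. *)
Definition vanish_below k r := [forall b : 'I_n, (b.+1 < k)%N ==> (mul_sub1 r b == 0)].
Definition from_row i r := [forall a : 'I_n, (a.+1 < i)%N ==> (r a == 0)].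
Definition row_entry i t r := [forall a : 'I_n, (a.+1 == i) ==> (r a == t)].

(* Here r ranges over all of F^n, but only its coordinates of index < k matter, whence the
   power of q in front. *)
Definition theta_sum_at k (Q : pred vec) : algC :=
  q ^+ k.-1 / q ^+ n *
  \sum_(r | Q r && vanish_below k r) theta (\sum_(b : 'I_n | b.+1 == k) mul_sub1 r b).

Definition perm_sum i k := theta_sum_at k (from_row i).
(** The entry is [- t] because the supercharacter is a sum over the orbit of $-\lambda$. *)
Definition arc_sum i k t := theta_sum_at k (fun r => from_row i r && row_entry i (- t) r).

Lemma eq_theta_sum_at k (Q Q' : pred vec) : Q =1 Q' -> theta_sum_at k Q = theta_sum_at k Q'.
Proof. by move=> E; congr (_ * _); apply: eq_bigl => r; rewrite E. Qed.

Lemma arc_sum0 i k : arc_sum i k 0 = perm_sum i.+1 k.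
Proof.
apply: eq_theta_sum_at => r; rewrite oppr0.
apply/andP/forallP => [[/forallP h /forallP h'] a|h].
  apply/implyP; rewrite ltnS leq_eqVlt => /orP[e|e]; first by have := h' a; rewrite e.
  by have := h a; rewrite e.
split; apply/forallP => a; apply/implyP => e; have := h a.
  by rewrite ltnS ltnW.
by rewrite ltnS leq_eqVlt e.
Qed.

Lemma perm_sum_split i k : (0 < i <= n)%N -> perm_sum i k = \sum_t arc_sum i k t.
Proof.
case: i => // i /= lt_in; pose i0 := Ordinal lt_in.
rewrite -mulr_sumr; congr (_ * _).
rewrite (partition_big (fun r => - r i0) predT) //=; apply: eq_bigr => t _.
apply: eq_bigl => r; rewrite -!andbA; congr (_ && _); rewrite andbC; congr (_ && _).
apply/eqP/forallP => [<- a|/(_ i0)]; last by rewrite eqxx => /eqP ->; rewrite opprK.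
by apply/implyP; rewrite opprK eqSS => /eqP e; rewrite (_ : a = i0) //; apply: val_inj.
Qed.

Lemma perm_sum_step i k : (0 < i <= n)%N ->
  perm_sum i k = perm_sum i.+1 k + \sum_(t | t != 0) arc_sum i k t.
Proof. by move=> hi; rewrite perm_sum_split // (bigD1 0) //= arc_sum0. Qed.

(* Subtracting a multiple of a vector r' of the longer arc from the vectors r of the
   shorter one clears their entry in row i, and changes none of the sums involved,
   as r' (u - 1) vanishes up to column j. *)
Lemma arc_sumM i j k s t : (j < k)%N -> t != 0 ->
  arc_sum i k t * arc_sum i j s = arc_sum i k t * perm_sum i.+1 j.
Proof.
(* As [perm_sum i.+1 j] is [arc_sum i j 0], the claim is that [s] may be replaced by 0. This is
   shown for each vector [r'] of the longer arc separately. *)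
move=> jk t0; rewrite -arc_sum0 /arc_sum /theta_sum_at -!mulrA; congr (_ * (_ * _)).
rewrite !mulr_suml; apply: eq_bigr => r' /andP[/andP[/forallP a' /forallP e'] /forallP v'].
congr (_ * (_ * (_ * _))).
have mul0 (b : 'I_n) : (b.+1 <= j)%N -> mul_sub1 r' b = 0.
  by move=> bj; apply/eqP; have := v' b; rewrite (leq_ltn_trans bj jk).
pose sh c r : vec := [ffun a => r a + c * r' a].
have shK c : cancel (sh c) (sh (- c)).
  by move=> r; apply/ffunP => a; rewrite !ffunE mulNr addrK.
have mulsh c r (b : 'I_n) : (b.+1 <= j)%N -> mul_sub1 (sh c r) b = mul_sub1 r b.
  by move=> bj; rewrite mul_sub1D mul0 // mulr0 addr0.
have key c s1 s2 r : s2 = s1 + c * t ->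
    (from_row i r && row_entry i (- s1) r) && vanish_below j r ->
    (from_row i (sh c r) && row_entry i (- s2) (sh c r)) && vanish_below j (sh c r).
  move=> -> /andP[/andP[/forallP h1 /forallP h2] /forallP h3].
  apply/andP; split; first (apply/andP; split).
  - apply/forallP => a; apply/implyP => ai; rewrite ffunE.
    have:= h1 a; have := a' a; rewrite ai => /eqP -> /eqP ->.
    by rewrite mulr0 addr0.
  - apply/forallP => a; apply/implyP => ai; rewrite ffunE.
    have:= h2 a; have := e' a; rewrite ai => /eqP -> /eqP ->.
    by rewrite mulrN opprD.
  apply/forallP => b; apply/implyP => bj; rewrite mulsh ?(ltnW bj) //.
  by have := h3 b; rewrite bj.
(* Since [r'] has [i]-th entry [- t], the shift by [s / t] turns the entry 0 into [- s]. *)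
rewrite (reindex_onto (sh (s / t)) (sh (- (s / t)))) /=; last first.
  by move=> r _; have := shK (- (s / t)) r; rewrite opprK.
apply: eq_big => [r|r _].
  rewrite shK eqxx andbT; apply/idP/idP; last by apply: key; rewrite divfK // add0r.
  move=> h; rewrite -[r](shK (s / t)); apply: (key _ s) h.
  by rewrite mulNr divfK // subrr.
congr (theta _); apply: eq_bigr => b /eqP bj.
by rewrite mulsh // bj.
Qed.

(** As $u-1$ is strictly upper triangular, a vector supported from [k] on has image zero up to
    column [k]. All terms are 1, and the number of vectors cancels the normalization. *)
Lemma perm_sum_diag k : (0 < k <= n)%N -> perm_sum k k = 1.
Proof.
case: k => // k /= lt_kn; rewrite /perm_sum /theta_sum_at /=.
have [t0 _ _] := htheta; have q0 := card_fin_neq0 F.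
have mul0 r (b : 'I_n) : from_row k.+1 r -> (b <= k)%N -> mul_sub1 r b = 0.
  move=> /forallP h bk; rewrite /mul_sub1 big1 // => a _.
  case: (ltnP a k) => ak; first by have := h a; rewrite ltnS ak => /eqP ->; rewrite mul0r.
  by rewrite nilp_low ?mulr0 // (leq_trans bk).
rewrite (eq_bigr (fun=> \prod_(a : 'I_n) 1)) => [|r /andP[hr _]]; last first.
  by rewrite big1_eq big1 // => b; rewrite eqSS => /eqP bk; rewrite mul0 ?bk.
rewrite (eq_bigl [pred r : vec | [forall a : 'I_n,
    (a.+1 < k.+1)%N ==> (r a == 0)]]) => [|r /=]; last first.
  rewrite -/(from_row k.+1 r); case hr: (from_row _ r) => //=.
  by apply/forallP => b; apply/implyP => bk; rewrite mul0 // ltnW.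
rewrite /= (@sum_ffun_coord F n (fun a x => (a.+1 < k.+1)%N ==> (x == 0)) (fun _ _ => 1)).
rewrite mulrAC -(prod_leq_card F (ltnW lt_kn)) -big_split /=.
rewrite (eq_bigr (fun=> q)) => [|a _]; last first.
  rewrite ltnS; case: ifP => _ /=; last by rewrite mul1r sumr_const.
  by rewrite (big_pred1 0) // mulr1.
by rewrite prodr_const card_ord divff // expf_neq0.
Qed.

Definition arc_factor la i k : algC :=
  if (i < k)%N && (label la i k != 0) then arc_sum i k (label la i k) else 1.

(** By [chi_arc_prod] this is the value at [u] of the supercharacter of [la], if [la] has at most
    one label in each row and column. *)
Definition arc_prod la : algC := \prod_(p : 'I_n * 'I_n) arc_factor la p.1.+1 p.2.+1.

Lemma label_add_arc i k t la a b :
  label (add_arc i k t la) a b = if (a, b) == (i, k) then t else label la a b.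
Proof. exact: fsfun_withE. Qed.

Lemma label_del_arc i k la a b :
  label (del_arc i k la) a b = if (a, b) == (i, k) then 0 else label la a b.
Proof. exact: fsfun_withE. Qed.

Lemma arc_prod_eq la la' i k : (0 < i)%N -> (i < k <= n)%N ->
  (forall a b, (a, b) != (i, k) -> label la a b = label la' a b) ->
  label la' i k = 0 -> arc_prod la = arc_factor la i k * arc_prod la'.
Proof.
case: i => // i _; case: k => // k /andP[ik kn] E l0.
have lt_in : (i < n)%N by apply: leq_trans kn; rewrite ltnW.
pose p0 : 'I_n * 'I_n := (Ordinal lt_in, Ordinal kn).
rewrite /arc_prod (bigD1 p0) //= [X in _ = _ * X](bigD1 p0) //=.
rewrite [arc_factor la' _ _]/arc_factor l0 eqxx andbF mul1r; congr (_ * _).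
by apply: eq_bigr => -[a b] /= ne; rewrite /arc_factor E.
Qed.

Lemma arc_prod_del la i k : (0 < i)%N -> (i < k <= n)%N -> label la i k != 0 ->
  arc_prod la = arc_sum i k (label la i k) * arc_prod (del_arc i k la).
Proof.
move=> i0 ik l0; rewrite (@arc_prod_eq la (del_arc i k la) i k) //.
- by rewrite /arc_factor l0; case/andP: ik => ->.
- by move=> a b ne; rewrite label_del_arc (negPf ne).
- by rewrite label_del_arc eqxx.
Qed.

Lemma arc_prod_add la i k t : (0 < i)%N -> (i < k <= n)%N -> label la i k = 0 -> t != 0 ->
  arc_prod (add_arc i k t la) = arc_sum i k t * arc_prod la.
Proof.
move=> i0 ik l0 t0; rewrite (@arc_prod_eq _ la i k) //.
- by rewrite /arc_factor !label_add_arc eqxx t0; case/andP: ik => ->.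
- by move=> a b ne; rewrite label_add_arc (negPf ne).
Qed.

End ArcSums.

(* The array of a labeled set partition of a subset of {1, ..., K}. *)
Definition quasi_monomial (F : finFieldType) K (la : lsp F) : Prop :=
  [/\ forall i j, label la i j != 0 -> [&& 0 < i, i < j & j <= K]%N,
      forall i j j', label la i j != 0 -> label la i j' != 0 -> j = j'
    & forall i i' j, label la i j != 0 -> label la i' j != 0 -> i = i'].

(** * Evaluation of the product by its recursion *)

Section Star.

Variables (F : finFieldType) (theta : F -> algC).
Hypothesis htheta : nontrivial_add_char theta.
Variables (n : nat) (u : unitri F n).

Lemma quasi_monomial_del K i j (la : lsp F) :
  quasi_monomial K la -> quasi_monomial K (del_arc i j la).
Proof.
have D a b : label (del_arc i j la) a b != 0 -> label la a b != 0.
  by rewrite label_del_arc; case: ifP; rewrite ?eqxx.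
case=> h1 h2 h3; split.
- by move=> a b /D; apply: h1.
- by move=> a b c /D h /D; apply: h2.
- by move=> a b c /D h /D; apply: h3.
Qed.

Lemma quasi_monomial_add K i k t (la : lsp F) :
  quasi_monomial K la -> (0 < i)%N -> (i < k <= K)%N ->
  (forall j, label la i j = 0) -> (forall j, label la j k = 0) ->
  quasi_monomial K (add_arc i k t la).
Proof.
case=> h1 h2 h3 i0 ik r0 c0; split.
- move=> a b; rewrite label_add_arc; have [[-> ->] _|_] := (a, b) =P (i, k).
    by rewrite i0.
  exact: h1.
- move=> a b c; rewrite !label_add_arc.
  have [[-> ->] _|ne] := (a, b) =P (i, k); have [[]|ne'] := (_, c) =P (i, k) => //.
  + by rewrite r0 eqxx.
  + by move=> -> _; rewrite r0 eqxx.
  + exact: h2.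
- move=> a b c; rewrite !label_add_arc.
  have [[-> ->] _|ne] := (a, c) =P (i, k); have [[]|ne'] := (b, _) =P (i, k) => //.
  + by rewrite c0 eqxx.
  + by move=> _ ->; rewrite c0 eqxx.
  + exact: h3.
Qed.

(** Each case of the recursion matches an identity between arc sums. [Phi] and [c] account for later
    factors: in [chi_comb_foldl], [Phi] multiplies by the remaining singletons and evaluates at [u],
    and [c] is the product of their [perm_sum]. *)
Lemma star_arc_prod (Phi : {linear {freeg (lsp F) / algC} -> algC^o}) (c : algC)
    K i k (mu : lsp F) :
  (K <= n)%N ->
  (forall la, quasi_monomial K la -> Phi (basis la) = arc_prod theta u la * c) ->
  quasi_monomial K mu -> (0 < i)%N -> (i <= k <= K)%N ->
  (forall j, label mu j k = 0) ->
  Phi (star i k mu) = arc_prod theta u mu * perm_sum theta u i k * c.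
Proof.
(* The induction is on a bound for [k - i], because a step may lower [k] to [j] while raising
   [i]. *)
move=> Kn hPhi; move: {2}(k - i)%N (leqnn (k - i)) => d.
elim: d i k mu => [|d IH] i k mu kd qm i0 /andP[ik kK] ck.
  have -> : i = k by apply/eqP; rewrite eqn_leq ik /= -subn_eq0 -leqn0.
  rewrite starE // eqxx perm_sum_diag // ?mulr1; last first.
    by rewrite (leq_trans i0 ik) (leq_trans kK).
  by rewrite hPhi.
rewrite starE //; case: eqP => [->|/eqP ne].
  rewrite perm_sum_diag // ?mulr1; last first.
    by rewrite (leq_trans i0 ik) (leq_trans kK).
  by rewrite hPhi.
have lt_ik : (i < k)%N by rewrite ltn_neqAle ne.
have le_kn := leq_trans kK Kn.
have le_in : (0 < i <= n)%N by rewrite i0 (leq_trans ik).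
have kd' : (k - i.+1 <= d)%N by rewrite subnS; case: (k - i)%N kd.
have [h1 h2 h3] := qm.
case: has_arc_beyondP => [[l kl l0]|hbeyond].
  have /and3P[_ il lK] := h1 _ _ l0.
  have ln : (i < l <= n)%N by rewrite il (leq_trans lK).
  (* Next to the factor of the longer arc from [i] to [l], [arc_sumM] makes all [q] summands of
     [perm_sum] at [i], [k] equal. *)
  have E : arc_prod theta u mu * perm_sum theta u i k =
      #|F|%:R * (arc_prod theta u mu * perm_sum theta u i.+1 k).
    rewrite (arc_prod_del theta u i0 ln l0).
    have E t := @arc_sumM _ theta _ u i k l t _ kl l0.
    rewrite (perm_sum_split theta u k le_in).
    move: (arc_sum _ _ _ l _) (arc_prod _ _ _) (perm_sum _ _ _ _) E => B X P E.
    rewrite mulrAC mulr_sumr (eq_bigr _ (fun t _ => E t)).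
    by rewrite sumr_const -[_ *+ _]mulr_natl -!mulrA [X * _]mulrC.
  by rewrite linearZ /= IH ?lt_ik // E; apply: mulrA.
have l0 : label mu i k = 0 by exact: ck.
rewrite l0 eqxx /=.
have IHk : Phi (star i.+1 k mu) = arc_prod theta u mu * perm_sum theta u i.+1 k * c.
  by apply: IH => //; rewrite lt_ik.
case: pickP => [j /andP[ij lij]|hrow].
  have jk := ltn_ord j; have jn := ltn_trans jk; have jK := ltnW (leq_trans jk kK).
  have ijn : (i < j <= n)%N by rewrite ij (leq_trans jK).
  rewrite linearD perm_sum_step // mulrDr mulrDl IHk; congr (_ + _).
  rewrite raddf_sum mulr_sumr mulr_suml; apply: eq_bigr => t t0.
  have row0 a : label (del_arc i j mu) i a = 0.
    rewrite label_del_arc; case: eqP => // ne'; apply/eqP/negP => /negP la0.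
    by case: ne'; rewrite (h2 _ _ _ lij la0).
  have col0 a : label (del_arc i j mu) a k = 0.
    by rewrite label_del_arc; case: eqP.
  (* Trading the arc to [j] for one to [k] empties column [j], so the induction hypothesis applies
     with [j] in place of [k]. *)
  rewrite /= IH //; first last.
  - move=> a; rewrite label_add_arc label_del_arc; case: eqP => [[_ e]|_].
      by rewrite e ltnn in jk.
    case: eqP => // ne'; apply/eqP/negP => /negP la0.
    by case: ne'; rewrite (h3 _ _ _ lij la0).
  - by rewrite ij.
  - by apply: quasi_monomial_add => //; [apply: quasi_monomial_del | rewrite lt_ik].
  - by apply: leq_trans kd'; rewrite leq_sub2r // ltnW.
  rewrite arc_prod_add // ?lt_ik // (arc_prod_del theta u i0 ijn lij).
  (* Now the new arc to [k] is the longer one, and it absorbs the factor of the deleted arc to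
     [j]. *)
  have := @arc_sumM _ theta _ u i j k (label mu i j) t jk t0.
  move: (arc_sum _ _ _ j _) (arc_sum _ _ _ _ _) (arc_prod _ _ _) (perm_sum _ _ _ _).
  by move=> B A X P E; congr (_ * _); rewrite mulrAC -E [RHS]mulrAC [B * A]mulrC.
(* An arc from [i] would end before, at or beyond [k]; all three are excluded, so adding an arc
   keeps the array quasi-monomial. *)
have row0 a : label mu i a = 0.
  apply/eqP/negP => /negP la0; have /and3P[_ ia _] := h1 _ _ la0.
  case: (ltngtP a k) => [ak|ka|ak].
  - by have := hrow (Ordinal ak); rewrite /= ia la0.
  - by apply: hbeyond; exists a.
  - by move: la0; rewrite ak l0 eqxx.
rewrite linearD perm_sum_step // mulrDr mulrDl IHk; congr (_ + _).
rewrite raddf_sum mulr_sumr mulr_suml; apply: eq_bigr => t t0.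
rewrite /= hPhi; last by apply: quasi_monomial_add => //; rewrite lt_ik.
by rewrite arc_prod_add ?lt_ik // [arc_sum _ _ _ _ _ * _]mulrC.
Qed.

End Star.

(** * Supercharacters as products over arcs *)

Section SupercharacterSum.

Variables (F : finFieldType) (theta : F -> algC) (n : nat).

Local Notation U := (unitri F n).

(** The inverse turns the left multiplication into a right action, as [is_action] requires. *)
Definition dual_left_act (l : dual F n) (a : U) : dual F n := dual_act a^-1%g l 1%g.

Lemma dual_left_act_is_action : is_action [set: U] dual_left_act.
Proof.
apply: is_total_action => [l|l a b]; first by rewrite /dual_left_act invg1 dual_act1.
by rewrite /dual_left_act dual_actA mulg1 invMg.
Qed.
Canonical dual_left_action := Action dual_left_act_is_action.

Definition dual_two_sided_act (l : dual F n) (a : U * U) : dual F n :=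
  dual_act a.1^-1%g l a.2.

Lemma dual_two_sided_act_is_action : is_action [set: U * U] dual_two_sided_act.
Proof.
apply: is_total_action => [l|l a b].
  by rewrite /dual_two_sided_act /= invg1 dual_act1.
by rewrite /dual_two_sided_act dual_actA /= invMg.
Qed.
Canonical dual_two_sided_action := Action dual_two_sided_act_is_action.

Lemma left_orbitE (l : dual F n) :
  left_orbit l = orbit dual_left_action [set: U] l.
Proof.
apply/setP => k; apply/imsetP/orbitP => [[a _ ->]|[a _ <-]].
  by exists a^-1%g; rewrite ?inE //= /dual_left_act invgK.
by exists a^-1%g; rewrite ?inE.
Qed.

Lemma two_sided_orbitE (l : dual F n) :
  two_sided_orbit l = orbit dual_two_sided_action [set: U * U] l.
Proof.
apply/setP => k; apply/imset2P/orbitP => [[a b _ _ ->]|[a _ <-]].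
  by exists (a^-1%g, b); rewrite ?inE //= /dual_two_sided_act invgK.
by exists a.1^-1%g a.2; rewrite ?inE.
Qed.

Lemma dual_opp_act a (l : dual F n) b :
  dual_act a (dual_opp l) b = dual_opp (dual_act a l b).
Proof.
apply: val_inj; apply/ffunP => x; rewrite [LHS]dual_actE [LHS]ffunE [RHS]ffunE.
by rewrite dual_actE.
Qed.

Lemma dual_oppK : involutive (@dual_opp F n).
Proof. by move=> l; apply: val_inj; apply/ffunP => x; rewrite !ffunE /dual_app /= ffunE opprK. Qed.

(** Negation commutes with the action. This reconciles the sum over the orbit of [dual_opp l] with
    the normalization by the orbits of [l]. *)
Lemma astab_dual_opp (l : dual F n) :
  ('C_[set: U * U][dual_opp l | dual_two_sided_action] =
   'C_[set: U * U][l | dual_two_sided_action])%g.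
Proof.
apply/setP => a; rewrite !inE /=.
rewrite !sub1set !inE /= /dual_two_sided_act dual_opp_act.
by rewrite (inj_eq (can_inj dual_oppK)).
Qed.

(** By the orbit-stabilizer theorem the two-sided stabilizer cancels between the normalization and
    the sum, and only the left stabilizer remains. *)
Lemma supercharacter_sumE (l : dual F n) (u : U) :
  supercharacter theta l u =
  (#|('C_[set: U][l | dual_left_action])%g|%:R * #|[set: U]|%:R)^-1 *
  \sum_(g : U) \sum_(h : U) theta (- l (nilp_mul g h (sub1 u))).
Proof.
have sumE : \sum_(g : U) \sum_(h : U) theta (- l (nilp_mul g h (sub1 u))) =
    #|('C_[set: U * U][l | dual_two_sided_action])%g|%:R *
    \sum_(nu in two_sided_orbit (dual_opp l)) theta (nu (sub1 u)).
  rewrite -astab_dual_opp two_sided_orbitE.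
  rewrite -(sum_act_orbit _ _ _ (fun nu : dual F n => theta (nu (sub1 u)))).
  (* The pair $(g,h)$ evaluates the functional at $g x h^{-1}$, so [h] is replaced by its
     inverse. *)
  under eq_bigr do rewrite (reindex_inj invg_inj).
  rewrite pair_bigA; apply: eq_big => [a|[g h] _]; first by rewrite inE.
  congr (theta _); rewrite /= /dual_two_sided_act dual_actE invgK.
  by rewrite [RHS]ffunE.
have := card_orbit_stab dual_left_action [set: U] l.
have := card_orbit_stab dual_two_sided_action [set: U * U] l.
rewrite cfunElock sumE /supercharacter_fun left_orbitE (two_sided_orbitE l) mulrA !cardsT card_prod.
move=> /(congr1 (fun x => x%:R : algC)); rewrite !natrM => eO.
move=> /(congr1 (fun x => x%:R : algC)); rewrite natrM => eL.
congr (_ * _); have N0 : #|U|%:R != 0 :> algC by rewrite -cardsT neq0CG.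
have O0 : #|orbit dual_two_sided_action [set: U * U] l|%:R != 0 :> algC.
  by apply: contraNneq (mulf_neq0 N0 N0) => O0; rewrite -eO O0 mul0r.
have S0 : #|('C_[set: U][l | dual_left_action])%g|%:R != 0 :> algC.
  by apply: contraNneq N0 => S0; rewrite -eL S0 mulr0.
apply: (mulIf O0); rewrite divfK // -mulrA [X in _ * X]mulrC eO invfM.
by rewrite mulrA mulfVK // -eL mulrC mulfK.
Qed.

End SupercharacterSum.

(** * Averaging over one column, then over one row *)

Section SupercharacterProduct.

Variables (F : finFieldType) (theta : F -> algC).
Hypothesis htheta : nontrivial_add_char theta.
Variables (n : nat) (u : unitri F n) (la : lsp F).
Hypothesis row_unique : forall i j j', label la i j != 0 -> label la i j' != 0 -> j = j'.
Hypothesis col_unique : forall i i' j, label la i j != 0 -> label la i' j != 0 -> i = i'.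

Local Notation U := (unitri F n).
Local Notation q := (#|F|%:R : algC).
Local Notation vec := {ffun 'I_n -> F}.
Local Notation lab i j := (label la (nat_of_ord i).+1 (nat_of_ord j).+1).

(* Matrix indices are ordinals starting at 0, whereas labels are indexed from 1. *)
Definition arcb (i j : 'I_n) := (i < j)%N && (lab i j != 0).

Lemma arc_row_unique i j j' : arcb i j -> arcb i j' -> j = j'.
Proof.
by move=> /andP[_ h] /andP[_ h']; apply: val_inj; have [] := row_unique h h'.
Qed.

Lemma arc_col_unique i i' j : arcb i j -> arcb i' j -> i = i'.
Proof.
by move=> /andP[_ h] /andP[_ h']; apply: val_inj; have [] := col_unique h h'.
Qed.

Lemma functional_ofE (x : Defs.nilp F n) :
  functional_of n la x = \sum_(j < n) \sum_(i < n | arcb i j) lab i j * x i j.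
Proof.
rewrite [LHS]ffunE (exchange_big_dep predT) //=; apply: eq_bigr => j _.
rewrite (bigID (fun i : 'I_n => lab i j != 0)) /= [X in _ + X]big1 ?addr0 // => i.
by case/andP => _ /negbNE/eqP ->; rewrite mul0r.
Qed.

(** What the arc from [i] to [j] contributes after summing over column [j] of the right multiplier,
    when [r] is row [i] of the left one. *)
Definition arc_term i j (r : vec) : algC :=
  if arcb i j then
    if vanish_below u j.+1 r then theta (- lab i j * mul_sub1 u r j) else 0
  else 1.

(** Column [j] holds at most one arc, so the coefficients of [c] are a multiple of one row of
    $g(u-1)$, and [sum_col_theta] applies. *)
Lemma arc_term_col (g : 'M[F]_n) (j : 'I_n) :
  \sum_(c | col_ok j c)
     theta (\sum_b (\sum_(i | arcb i j) - lab i j * mul_sub1 u (row_of g i) b) * c b) =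
  q ^+ j * \prod_i arc_term i j (row_of g i).
Proof.
have [t0 _ _] := htheta.
rewrite sum_col_theta //; case: (pickP (fun i => arcb i j)) => [i ij|h]; last first.
  rewrite [X in theta X]big_pred0 // t0 [X in _ = _ * X]big1 => [|i _]; last by rewrite /arc_term h.
  case: ifP => // /negP[]; apply/forallP => b; apply/implyP => _.
  by rewrite big_pred0.
have E b : \sum_(i | arcb i j) - lab i j * mul_sub1 u (row_of g i) b =
           - lab i j * mul_sub1 u (row_of g i) b.
  rewrite (big_pred1 i) // => i'; apply/idP/eqP => [i'j|-> //].
  exact: arc_col_unique i'j ij.
rewrite E (bigD1 i) //= [X in _ * (_ * X)]big1 => [|i' ne]; last first.
  rewrite /arc_term; case: ifP => // i'j.
  by rewrite (arc_col_unique i'j ij) eqxx in ne.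
rewrite mulr1 /arc_term ij.
have -> : vanish_below u j.+1 (row_of g i) =
   [forall b : 'I_n, (b < j)%N ==>
      (\sum_(i | arcb i j) - lab i j * mul_sub1 u (row_of g i) b == 0)].
  apply: eq_forallb => b; rewrite E ltnS mulf_eq0 oppr_eq0.
  by case/andP: ij => _ /negPf ->.
by case: ifP => _; rewrite ?mulr0.
Qed.

(** By [left_stabP] these are the conditions on row [i] that define the left stabilizer of the
    functional. *)
Definition stab_ok (i : 'I_n) (r : vec) :=
  [forall j, arcb i j ==> [forall a : 'I_n, (i < a < j)%N ==> (r a == 0)]].

(** The entries before [j] are prescribed and the other [n - j] are free. *)
Lemma card_row_lt (i j : 'I_n) : (i < j)%N ->
  (\sum_(r : vec | row_ok i r && [forall a : 'I_n, (i < a < j)%N ==> (r a == 0)]) 1) * q ^+ j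
    = q ^+ n.
Proof.
move=> ij.
rewrite (eq_bigl [pred r : vec | [forall a : 'I_n,
   (if a == i then r a == 1 else (a < j)%N ==> (r a == 0))]]) => [|r /=]; last first.
  apply/andP/forallP => [[/forallP h /forallP h'] a|h].
    have := h a; have := h' a; case: (a =P i) => // ne.
    by case: (ltngtP a i) => //= [_ _ /eqP ->|/val_inj]; rewrite ?eqxx ?implybT.
  split; apply/forallP => a; have := h a; case: (a =P i) => [->|ne] //; rewrite ?ltnn //.
    by move/implyP => h1; apply/implyP => ai; apply: h1; apply: ltn_trans ij.
  by move/implyP => h1; apply/implyP => /andP[_ ai]; apply: h1.
rewrite (eq_bigr (fun r => \prod_(a : 'I_n) 1)) => [|r _]; last by rewrite big1_eq.
rewrite /= (@sum_ffun_coord F n (fun a x => if a == i then x == 1 else (a < j)%N ==> (x == 0))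
  (fun _ _ => 1)).
rewrite -(prod_leq_card F (ltnW (ltn_ord j))) -big_split /=.
rewrite (eq_bigr (fun=> q)) => [|a _]; first by rewrite prodr_const card_ord.
case: eqP => [->|_]; first by rewrite ij (big_pred1 1) // mul1r.
case: ifP => _ /=; last by rewrite mulr1 sumr_const.
by rewrite (big_pred1 0) // mul1r.
Qed.

(** If row [i] has an arc, scaling by minus its label turns the diagonal entry 1 into the entry
    required by [arc_sum], whose normalization is the inverse of the number of stabilizing rows.
    Otherwise both sides count all admissible rows. *)
Lemma arc_term_row (i : 'I_n) :
  \sum_(r | row_ok i r) \prod_j arc_term i j r =
  (\sum_(r | row_ok i r && stab_ok i r) 1) * \prod_(j < n) arc_factor theta u la i.+1 j.+1.
Proof.
have q0 := card_fin_neq0 F.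
have facE (j : 'I_n) : arc_factor theta u la i.+1 j.+1 = if arcb i j then 
  arc_sum theta u i.+1 j.+1 (lab i j) else 1.
  by [].
case: (pickP (fun j => arcb i j)) => [j ij|h]; last first.
  rewrite [X in _ * X]big1 => [|j _]; last by rewrite facE h.
  rewrite mulr1; apply: eq_big => [r|r _]; last by rewrite big1 // => j _; rewrite /arc_term h.
  by rewrite (_ : stab_ok i r) ?andbT //; apply/forallP => j; rewrite h.
have lt_ij : (i < j)%N by case/andP: ij.
have l0 : lab i j != 0 by case/andP: ij.
have uniq j' : j' != j -> arcb i j' = false.
  by move=> ne; apply/negP => ij'; rewrite (arc_row_unique ij' ij) eqxx in ne.
have -> : \prod_(j < n) arc_factor theta u la i.+1 j.+1 = arc_sum theta u i.+1 j.+1 (lab i j).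
  rewrite (bigD1 j) //= facE ij big1 ?mulr1 // => j' ne.
  by rewrite facE uniq.
rewrite [X in _ = X * _](eq_bigl (fun r : vec => row_ok i r &&
    [forall a : 'I_n, (i < a < j)%N ==> (r a == 0)])) => [|r /=]; last first.
  congr (_ && _); apply/forallP/forallP => [h a|h j'].
    by have := h j; rewrite ij => /forallP/(_ a).
  apply/implyP => ij'; rewrite (arc_row_unique ij' ij).
  exact/forallP.
have qj : q ^+ j != 0 by rewrite expf_neq0.
apply: (mulIf qj); rewrite mulrAC card_row_lt // /arc_sum /theta_sum_at /=.
rewrite mulrA mulrCA divff ?expf_neq0 // mulr1 mulrC; congr (_ * _).
transitivity (\sum_(r | row_ok i r && vanish_below u j.+1 r) theta (- lab i j * mul_sub1 u r j)).
  rewrite big_mkcondr; apply: eq_bigr => r _.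
  rewrite (bigD1 j) //= /arc_term ij big1 ?mulr1 // => j' ne.
  by rewrite uniq.
pose sc c (r : vec) : vec := [ffun a => c * r a].
have mulsc c r b : mul_sub1 u (sc c r) b = c * mul_sub1 u r b.
  by rewrite /mul_sub1 mulr_sumr; apply: eq_bigr => a _; rewrite ffunE mulrA.
have scK c c' : c * c' = 1 -> cancel (sc c') (sc c).
  by move=> e r; apply/ffunP => a; rewrite !ffunE mulrA e mul1r.
have c0 : - lab i j != 0 by rewrite oppr_eq0.
rewrite [RHS](reindex_onto (sc (- lab i j)) (sc (- lab i j)^-1)) => [|r _]; last first.
  by apply: scK; rewrite mulfV.
apply: eq_big => [r|r _].
  rewrite scK ?eqxx ?andbT ?mulVf //; congr (_ && _).
    apply/forallP/andP => [h|[/forallP h1 /forallP h2] a].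
      split; apply/forallP => a; apply/implyP => ai; rewrite ffunE; have := h a.
        by rewrite -val_eqE ltn_eqF //= -ltnS ai => /eqP ->; rewrite mulr0.
      by rewrite -val_eqE -eqSS ai => /eqP ->; rewrite mulr1.
    have := h1 a; have := h2 a; rewrite !ffunE eqSS ltnS val_eqE.
    rewrite mulf_eq0 (negPf c0) /=; case: (a =P i) => //= -> /eqP e _.
    by rewrite -(inj_eq (mulfI c0)) e mulr1.
  apply: eq_forallb => b; rewrite mulsc mulf_eq0 (negPf c0) //.
by congr (theta _); rewrite (big_pred1 j) ?mulsc // => b; rewrite eqSS.
Qed.

End SupercharacterProduct.

(** * The left stabilizer and the product formula *)

Section SupercharacterFormula.

Variables (F : finFieldType) (theta : F -> algC).
Hypothesis htheta : nontrivial_add_char theta.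
Variables (n : nat) (u : unitri F n) (la : lsp F).
Hypothesis row_unique : forall i j j', label la i j != 0 -> label la i j' != 0 -> j = j'.
Hypothesis col_unique : forall i i' j, label la i j != 0 -> label la i' j != 0 -> i = i'.

Local Notation U := (unitri F n).
Local Notation q := (#|F|%:R : algC).
Local Notation vec := {ffun 'I_n -> F}.
Local Notation lab i j := (label la (nat_of_ord i).+1 (nat_of_ord j).+1).
Local Notation arcb := (arcb la).
Local Notation stab_ok := (stab_ok la).
Local Notation arc_term := (arc_term theta u la).
Lemma dual_left_act_functional (g : U) (x : Defs.nilp F n) :
  dual_left_act (functional_of n la) g x =
  \sum_(j < n) \sum_(i < n | arcb i j) lab i j * (g *m x) i j.
Proof.
rewrite [LHS]dual_actE functional_ofE; apply: eq_bigr => j _; apply: eq_bigr => i _.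
by rewrite invgK invg1 /= mulmx1.
Qed.

Lemma left_stabP (g : U) :
  reflect (forall i, stab_ok i (row_of g i))
    (g \in ('C_[set: U][functional_of n la | dual_left_action F n])%g).
Proof.
have -> : (g \in ('C_[set: U][functional_of n la | dual_left_action F n])%g) =
    (dual_left_act (functional_of n la) g == functional_of n la).
  by rewrite !inE sub1set inE.
apply: (iffP eqP) => [e i|ok].
  apply/forallP => j; apply/implyP => ij; apply/forallP => a; apply/implyP => /andP[ia aj].
  have dP : delta_mx a j \is strict_upper F n.
    apply/strict_upperP => b c cb; rewrite mxE; case: eqP => // eb; case: eqP => //= ec.
    by rewrite eb ec leqNgt aj in cb.
  (* Testing on the matrix unit at [(a, j)] isolates the label of the arc times [g i a], since
     column [j] holds no other label. *)
  have := congr1 (fun l : dual F n => l (Nilp dP)) e.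
  rewrite (@functional_of_delta F n la (Nilp dP) a j) // dual_left_act_functional.
  have -> : lab a j = 0.
    apply/eqP/negP => /negP aj0; have /andP[_ ij0] := ij.
    by case: (col_unique aj0 ij0) ia => ->; rewrite ltnn.
  rewrite (bigD1 j) //= [X in _ + X]big1 => [|j' ne]; last first.
    rewrite big1 // => i' _; rewrite mxE big1 ?mulr0 // => b _.
    by rewrite mxE (negPf ne) andbF mulr0.
  rewrite addr0 (big_pred1 i) => [|i']; last first.
    by apply/idP/eqP => [h|-> //]; apply: (arc_col_unique col_unique h ij).
  rewrite mxE (bigD1 a) //= big1 => [|b ne]; last first.
    by rewrite mxE (negPf ne) mulr0.
  rewrite addr0 mxE !eqxx mulr1 ffunE => /eqP.
  by rewrite mulf_eq0; case/andP: ij => _ /negPf ->.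
apply: val_inj; apply/ffunP => x; rewrite [LHS]dual_left_act_functional [RHS]functional_ofE.
apply: eq_bigr => j _; apply: eq_bigr => i ij; congr (_ * _).
rewrite mxE (bigD1 i) //= unitri_diag mul1r big1 ?addr0 // => a ne.
case: (ltnP a j) => aj; last by rewrite nilp_low ?mulr0.
case: (ltngtP a i) => [ai|ia|/val_inj e]; last by rewrite e eqxx in ne.
  by rewrite unitri_low ?mul0r.
have /forallP/(_ j) := ok i; rewrite ij => /forallP/(_ a).
by rewrite ia aj ffunE => /eqP ->; rewrite mul0r.
Qed.

Lemma card_left_stab :
  #|('C_[set: U][functional_of n la | dual_left_action F n])%g|%:R =
  \prod_(i < n) \sum_(r | row_ok i r && stab_ok i r) 1 :> algC.
Proof.
under [RHS]eq_bigr do rewrite big_mkcondr /=.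
rewrite -(@sum_rows F n (fun i r => if stab_ok i r then 1 else 0)) -sum1_card natr_sum big_mkcond.
apply: eq_bigr => g _; case: left_stabP => [ok|nok].
  by rewrite big1 // => i _; rewrite ok.
case: (pickP (fun i => ~~ stab_ok i (row_of g i))) => [i /negPf ni|h].
  by rewrite (bigD1 i) //= ni mul0r.
by case: nok => i; apply/negPn; rewrite h.
Qed.

Lemma card_unitri : #|[set: U]|%:R = \prod_(j < n) q ^+ j :> algC.
Proof.
rewrite -sum1_card natr_sum.
transitivity (\sum_(g : U) \prod_(i < n) (fun _ _ => 1) i (col_of g i) : algC).
  by apply: eq_big => [g|g _]; rewrite ?inE // big1.
rewrite (sum_cols (fun _ _ => 1)); apply: eq_bigr => j _.
(* With zero coefficients [sum_col_theta] merely counts the admissible columns. *)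
rewrite -[RHS]mulr1 -[X in _ * X](_ : theta 0 = 1); last by case: htheta.
have := @sum_col_theta F theta htheta n j (fun=> 0).
rewrite (_ : [forall _, _] = true); last by apply/forallP => b; rewrite eqxx implybT.
move=> <-; apply: eq_bigr => c _; rewrite big1 => [|b _]; last by rewrite mul0r.
by case: htheta.
Qed.

(** For fixed [g], the sum over [h] factors over the columns of [h]; the result factors over the
    rows of [g]. The powers of [q] cancel the order of the group, and the numbers of stabilizing
    rows cancel the stabilizer. *)
Lemma chi_arc_prod : chi theta n la u = arc_prod theta u la.
Proof.
rewrite /chi supercharacter_sumE card_left_stab card_unitri.
have E (g : U) : \sum_(h : U) theta (- functional_of n la (nilp_mul g h (sub1 u))) =
   \prod_(j < n) q ^+ j * \prod_i \prod_j arc_term i j (row_of g i).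
  rewrite exchange_big -big_split /=; under [RHS]eq_bigr do rewrite -arc_term_col //.
  rewrite -(@sum_cols F n (fun j c => theta (
    \sum_b (\sum_(i | arcb i j) - lab i j * mul_sub1 u (row_of g i) b) * c b))).
  apply: eq_bigr => h _; rewrite -theta_sum //; congr (theta _).
  rewrite functional_ofE -sumrN; apply: eq_bigr => j _.
  under [RHS]eq_bigr do rewrite mulr_suml.
  rewrite exchange_big -sumrN /=; apply: eq_bigr => i ij.
  rewrite -mulNr mxE mulr_sumr; apply: eq_bigr => b _.
  rewrite -mulrA; congr (_ * _); rewrite mxE ffunE /mul_sub1; congr (_ * _).
  by apply: eq_bigr => a _; rewrite ffunE.
rewrite (eq_bigr _ (fun g _ => E g)) -mulr_sumr.
rewrite (@sum_rows F n (fun i r => \prod_j arc_term i j r)).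
under eq_bigr do rewrite arc_term_row //.
rewrite big_split /= /arc_prod.
rewrite -(pair_bigA _ (fun i j : 'I_n => arc_factor theta u la i.+1 j.+1)) /=.
have S0 : \prod_(i < n) \sum_(r | row_ok i r && stab_ok i r) 1 != 0 :> algC.
  by rewrite -card_left_stab neq0CG.
have N0 : \prod_(j < n) q ^+ j != 0 by rewrite -card_unitri neq0CG.
move: (\prod_(i < n) \sum_(r | _) _) (\prod_(j < n) q ^+ j) (\prod_i \prod_j _) S0 N0.
move=> S N X S0 N0.
by rewrite [N * _]mulrCA [S * (N * X)]mulrA mulKf // mulf_neq0.
Qed.

End SupercharacterFormula.

(** * Induction *)

Section Embed.

Variables (F : finFieldType) (theta : F -> algC) (m n : nat).
Hypothesis lemn : (m <= n)%N.

Local Notation q := (#|F|%:R : algC).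

Definition ffun_widen (r : {ffun 'I_n -> F}) : {ffun 'I_m -> F} :=
  [ffun a => r (widen_ord lemn a)].

(** All fibres of the truncation to the first [m] coordinates have the same size. Hence the
    normalized sums do not depend on the ambient dimension. *)
Lemma sum_ffun_widen (Q : pred {ffun 'I_m -> F}) (f : {ffun 'I_m -> F} -> algC) :
  (\sum_(r | Q (ffun_widen r)) f (ffun_widen r)) / q ^+ n = (\sum_(v | Q v) f v) / q ^+ m.
Proof.
have q0 := card_fin_neq0 F.
have fib v : \sum_(r | ffun_widen r == v) (1 : algC) = q ^+ n / q ^+ m.
  rewrite (eq_bigl [pred r : {ffun 'I_n -> F} | [forall a : 'I_n,
     [forall a' : 'I_m, (widen_ord lemn a' == a) ==> (r a == v a')]]]) => [|r /=]; last first.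
    apply/eqP/forallP => [<- a|h].
      by apply/forallP => a'; apply/implyP => /eqP <-; rewrite ffunE.
    apply/ffunP => a'; rewrite ffunE; apply/eqP.
    by have /forallP/(_ a') := h (widen_ord lemn a'); rewrite eqxx.
  rewrite (eq_bigr (fun r => \prod_(a : 'I_n) 1)) => [|r _]; last by rewrite big1_eq.
  rewrite /= (@sum_ffun_coord F n (fun a x =>
    [forall a' : 'I_m, (widen_ord lemn a' == a) ==> (x == v a')]) (fun _ _ => 1)).
  apply: (mulIf (expf_neq0 m q0)); rewrite divfK ?expf_neq0 //.
  rewrite -(prod_leq_card F lemn) -big_split /=.
  rewrite (eq_bigr (fun=> q)) => [|a _]; first by rewrite prodr_const card_ord.
  case: (embed_case lemn a) => [ma|[a' ->]].
    rewrite (leqNgt m) in ma; rewrite (negPf ma) mulr1 (eq_bigl xpredT) ?sumr_const // => x.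
    apply/forallP => a'; apply/implyP => /eqP e.
    by case/negP: ma; rewrite -e /= ltn_ord.
  rewrite /= ltn_ord (big_pred1 (v a')) ?mul1r // => x.
  apply/forallP/eqP => [/(_ a')|-> b]; first by rewrite eqxx => /eqP.
  by apply/implyP => /eqP/(congr1 val) /= e; rewrite (_ : a' = b) //; apply: val_inj.
rewrite (partition_big ffun_widen Q) //= mulr_suml [RHS]mulr_suml; apply: eq_bigr => v Qv.
rewrite (eq_bigr (fun=> f v * 1)) => [|r /andP[_ /eqP ->]]; last by rewrite mulr1.
rewrite -mulr_sumr (eq_bigl (fun r => ffun_widen r == v)) => [|r]; last first.
  by case: eqP => [->|_]; rewrite ?Qv ?andbF.
by rewrite fib -mulrA; congr (_ * _); rewrite mulrAC divff ?expf_neq0 ?mul1r.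
Qed.

Lemma mul_sub1_embed (u : unitri F m) r (b : 'I_m) :
  mul_sub1 (embed lemn u) r (widen_ord lemn b) = mul_sub1 u (ffun_widen r) b.
Proof.
rewrite /mul_sub1 (bigID (fun a : 'I_n => (a < m)%N)) /= [X in _ + X]big1 => [|a].
  rewrite addr0 (big_ord_narrow lemn); apply: eq_bigr => a _.
  by rewrite ffunE !mxE /= !valK.
rewrite -leqNgt => ma; rewrite !mxE -/(embed_mx n u a (widen_ord lemn b)).
by have := @embed_mx_out F m n u a (widen_ord lemn b); rewrite ma mxE => -> //; rewrite subrr mulr0.
Qed.

(** As [k <= m], every condition and the argument of [theta] depend only on the first [m]
    coordinates. *)
Lemma arc_sum_embed (u : unitri F m) i k t : (i < k <= m)%N ->
  arc_sum theta (embed lemn u) i k t = arc_sum theta u i k t.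
Proof.
case/andP => ik km; have im := leq_trans (ltnW ik) km.
have forall_widen (C : pred nat) (p : 'I_n -> bool) : (forall a, C a -> (a < m)%N) ->
    [forall a : 'I_n, C a ==> p a] = [forall a : 'I_m, C a ==> p (widen_ord lemn a)].
  move=> hC; apply/forallP/forallP => h a; first exact: h (widen_ord lemn a).
  case: (embed_case lemn a) => [ma|[a' ->]]; last exact: h.
  by apply/implyP => /hC; rewrite ltnNge ma.
rewrite /arc_sum /theta_sum_at -!mulrA; congr (_ * _); rewrite mulrC [RHS]mulrC.
rewrite -(sum_ffun_widen _ (fun r => theta (\sum_(b : 'I_m | b.+1 == k) mul_sub1 u r b))).
congr (_ / _); apply: eq_big => [r|r _].
  congr (_ && _ && _).
  - rewrite [LHS](forall_widen (fun a => (a.+1 < i)%N)) => [|a ai]; last first.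
      by rewrite ltnW // (leq_trans ai).
    by apply: eq_forallb => a; rewrite ffunE.
  - rewrite [LHS](forall_widen (fun a => (a.+1 == i)%N)) => [|a /eqP ai]; last by rewrite ai.
    by apply: eq_forallb => a; rewrite ffunE.
  - rewrite [LHS](forall_widen (fun a => (a.+1 < k)%N)) => [|a ai]; last first.
      by rewrite ltnW // (leq_trans ai).
    by apply: eq_forallb => a; rewrite mul_sub1_embed.
congr (theta _); rewrite (bigID (fun a : 'I_n => (a < m)%N)) /= [X in _ + X]big1 => [|b].
  rewrite addr0 (big_ord_narrow_cond lemn) /=; apply: eq_bigr => b _.
  exact: mul_sub1_embed.
by case/andP => /eqP bk; rewrite bk km.
Qed.

Lemma arc_prod_embed (u : unitri F m) (la : lsp F) : quasi_monomial m la ->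
  arc_prod theta (embed lemn u) la = arc_prod theta u la.
Proof.
case=> h _ _.
have fac0 i k : (m < i)%N || (m < k)%N -> arc_factor theta (embed lemn u) la i k = 1.
  rewrite /arc_factor; case: ifP => // /andP[_ /h /and3P[_ ik km]].
  by rewrite !ltnNge km (leq_trans (ltnW ik) km).
rewrite /arc_prod -(pair_bigA _ (fun i j : 'I_n => arc_factor _ _ _ i.+1 j.+1)).
rewrite -(pair_bigA _ (fun i j : 'I_m => arc_factor _ _ _ i.+1 j.+1)) /=.
rewrite (bigID (fun a : 'I_n => (a < m)%N)) /= [X in _ * X]big1 ?mulr1 => [|a]; last first.
  by rewrite -leqNgt => ma; rewrite big1 // => b _; rewrite fac0 // ltnS ma.
rewrite (big_ord_narrow lemn); apply: eq_bigr => a _.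
rewrite (bigID (fun a : 'I_n => (a < m)%N)) /= [X in _ * X]big1 ?mulr1 => [|b]; last first.
  by rewrite -leqNgt => mb; rewrite fac0 // !ltnS mb orbT.
rewrite (big_ord_narrow lemn); apply: eq_bigr => b _.
rewrite /arc_factor /=; case: ifP => // /andP[ab _].
by rewrite arc_sum_embed // ab ltn_ord.
Qed.

End Embed.

(** * The permutation character, column by column *)

Section PermutationCharacter.

Variables (F : finFieldType) (theta : F -> algC).
Hypothesis htheta : nontrivial_add_char theta.
Variables (m n : nat) (lemn : (m <= n)%N) (u : unitri F n).

Local Notation q := (#|F|%:R : algC).
Local Notation vec := {ffun 'I_n -> F}.

Definition fixes (c : vec) := [forall a, \sum_b sub1 u a b * c b == 0].

(** The indicator of $(u-1)c=0$ is the average of [theta] at $r(u-1)c$ over all [r]. Exchanging the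
    sums and summing over [c] first gives [perm_sum]. *)
Lemma perm_sum_fixed (k : 'I_n) :
  perm_sum theta u 1 k.+1 = \sum_(c | col_ok k c) (fixes c)%:R.
Proof.
have q0 := card_fin_neq0 F.
have fixE (c : vec) :
    (fixes c)%:R = (q ^+ n)^-1 * \sum_(r : vec) theta (\sum_b mul_sub1 u r b * c b).
  have E (r : vec) : theta (\sum_b mul_sub1 u r b * c b) =
      \prod_a theta ((\sum_b sub1 u a b * c b) * r a).
    rewrite -theta_sum //; congr (theta _).
    under eq_bigr do rewrite mulr_suml; rewrite exchange_big /=; apply: eq_bigr => a _.
    by rewrite mulrC mulr_sumr; apply: eq_bigr => b _; rewrite mulrA.
  under eq_bigr do rewrite E.
  rewrite -(bigA_distr_bigA (fun a x => theta ((\sum_b sub1 u a b * c b) * x))) /=.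
  under eq_bigr do rewrite sum_theta //.
  case: (boolP (fixes c)) => [/forallP h|].
    rewrite (eq_bigr (fun=> q)) => [|a _]; last by rewrite h.
    by rewrite prodr_const card_ord mulVf ?expf_neq0.
  by rewrite negb_forall => /existsP[a na]; rewrite (bigD1 a) //= (negPf na) mul0r mulr0.
under eq_bigr do rewrite fixE.
rewrite -mulr_sumr exchange_big /=; under eq_bigr do rewrite sum_col_theta //.
rewrite /perm_sum /theta_sum_at /= mulrAC mulrC; congr (_ * _).
rewrite -big_mkcond mulr_sumr; apply: eq_big => [r|r _].
  rewrite (_ : from_row 1 r = true); last by apply/forallP => a.
  by apply: eq_forallb => b; rewrite ltnS.
by congr (_ * theta _); rewrite (big_pred1 k) // => b; rewrite eqSS.
Qed.

(** Column [k] of [u ^ y] is a unit vector exactly when column [k] of $y\,u^y = uy$ is column [k] of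
    $y$, that is, when [u] fixes the latter. *)
Lemma conj_sub_unitriE (y : unitri F n) :
  ((u ^ y)%g \in sub_unitri F m n) = [forall k : 'I_n, (m <= k)%N ==> fixes (col_of y k)].
Proof.
have yw : y *m (u ^ y)%g = u *m y.
  have : (y * u ^ y = u * y)%g by rewrite conjgE !mulgA mulgV mul1g.
  by move/(congr1 val).
have fixP k : reflect (col k (u *m y) = col k y) (fixes (col_of y k)).
  have E a : \sum_b sub1 u a b * col_of y k b = (u *m y) a k - y a k.
    rewrite -[y : 'M_n in X in _ - X]mul1mx -[(1%:M *m y) a k]/(_ a k).
    rewrite !mxE -sumrB; apply: eq_bigr => b _.
    by rewrite ffunE !mxE mulrBl.
  apply: (iffP forallP) => [h|e a].
    by apply/matrixP => a b; have := h a; rewrite E subr_eq0 !mxE => /eqP.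
  by have /matrixP/(_ a 0) := e; rewrite E subr_eq0 ![col _ _ _ _]mxE => ->.
apply/sub_unitriP/forallP => [h k|h i j ij mj].
  apply/implyP => mk; apply/fixP; rewrite -yw; apply/matrixP => a b.
  rewrite !mxE (bigD1 k isT) (unitri_diag (u ^ y)%g) mulr1 big1 ?[LHS]addr0 //= => c ne.
  case: (ltngtP c k) => [ck|kc|/val_inj e]; last by rewrite e eqxx in ne.
    by rewrite h ?mulr0.
  by rewrite (unitri_low (u ^ y)%g) ?mulr0.
have := h j; rewrite mj => /fixP; rewrite -yw colE -mulmxA -colE.
move/(congr1 (mulmx (invmx y))); rewrite mulKmx ?unitri_unitmx //.
rewrite [in RHS]colE mulKmx ?unitri_unitmx // => /matrixP/(_ i 0).
by rewrite !mxE -val_eqE /= ltn_eqF.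
Qed.

(** The condition splits over the columns of [y]: those before [m] are free and number the order of
    the subgroup, and the others are counted by [perm_sum_fixed]. *)
Lemma card_conj_sub_unitri :
  \sum_(y : unitri F n) ((u ^ y)%g \in sub_unitri F m n)%:R =
  #|sub_unitri F m n|%:R * \prod_(k < n | (m <= k)%N) perm_sum theta u 1 k.+1 :> algC.
Proof.
have -> : #|sub_unitri F m n|%:R = \prod_(k < m) q ^+ k.
  by rewrite -(card_unitri htheta) (isom_card (embed_isom F lemn)).
transitivity (\sum_(y : unitri F n) \prod_(k < n)
    (fun (k : 'I_n) c => if (m <= k)%N then (fixes c)%:R else 1) k (col_of y k) : algC).
  apply: eq_bigr => y _; rewrite conj_sub_unitriE.
  case: (boolP [forall _, _]) => [/forallP h|].
    by rewrite big1 // => k _; case: ifP => // mk; have := h k; rewrite mk /= => ->.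
  rewrite negb_forall => /existsP[k]; rewrite negb_imply => /andP[mk nf].
  by rewrite (bigD1 k) //= mk (negPf nf) mul0r.
rewrite (sum_cols (fun (k : 'I_n) c => if (m <= k)%N then (fixes c)%:R else 1)).
rewrite (bigID (fun k : 'I_n => (m <= k)%N)) /= mulrC; congr (_ * _).
  rewrite (eq_bigl (fun k : 'I_n => (k < m)%N)) => [|k]; last by rewrite -ltnNge.
  rewrite (big_ord_narrow lemn); apply: eq_bigr => k _.
  rewrite leqNgt /= ltn_ord /=.
  have [t0 _ _] := htheta.
  have := @sum_col_theta F theta htheta n (widen_ord lemn k) (fun=> 0).
  rewrite (_ : [forall _, _] = true) ?t0 ?mulr1 => [<-|]; last first.
    by apply/forallP => b; rewrite eqxx implybT.
  by apply: eq_bigr => c _; rewrite big1 ?t0 // => b _; rewrite mul0r.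
by apply: eq_bigr => k mk; rewrite perm_sum_fixed mk.
Qed.

End PermutationCharacter.

(** * Comparison of induction with the iterated product *)

Section Branching.

Variables (F : finFieldType) (theta : F -> algC).
Hypothesis htheta : nontrivial_add_char theta.

Lemma chi_quasi_monomial n (u : unitri F n) K (la : lsp F) :
  quasi_monomial K la -> chi theta n la u = arc_prod theta u la.
Proof. by case=> _ h2 h3; apply: chi_arc_prod. Qed.

Lemma Ind_unitri_chi m n (lemn : (m <= n)%N) (mu : lsp F) (u : unitri F n) :
  quasi_monomial m mu ->
  Ind_unitri lemn (chi theta m mu) u =
  arc_prod theta u mu * \prod_(k < n | (m <= k)%N) perm_sum theta u 1 k.+1.
Proof.
move=> qm; rewrite /Ind_unitri (cfIndE (H := sub_unitri_group F m n)) ?subsetT //.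
rewrite (eq_bigr (fun y => ((u ^ y)%g \in sub_unitri F m n)%:R * arc_prod theta u mu)).
  rewrite -mulr_suml (eq_bigl xpredT) => [|y]; last by rewrite inE.
  rewrite (card_conj_sub_unitri htheta lemn) -mulrA mulKf 1?mulrC //.
  exact: (neq0CG (sub_unitri_group F m n)).
move=> y _; case: (boolP (_ \in _)) => [|nin]; last by rewrite mul0r cfun0.
(* The arc product at [u] is the value of a class function of the large group, so it may be computed
   at the conjugate [u ^ y] lying in the subgroup. *)
rewrite mul1r -(chi_quasi_monomial u qm) -(cfunJ _ u (in_setT y)).
move=> uyS; have /morphimP[v _ _ ->] : (u ^ y)%g \in (embed lemn @* [set: unitri F m])%g.
  by rewrite (isom_im (embed_isom F lemn)).
rewrite cfIsomE ?inE // !(chi_quasi_monomial _ qm).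
by rewrite arc_prod_embed.
Qed.

Lemma chi_comb_foldl_linear n (u : unitri F n) s :
  linear (fun D : {freeg (lsp F) / algC} =>
    chi_comb theta n (foldl (fun D k => star_comb 1 k D) D s) u : algC^o).
Proof.
elim: s => [|k s IH] a x y /=.
  by rewrite /chi_comb fglift_linear !cfunE.
by rewrite /star_comb fglift_linear; apply: IH.
Qed.

(** Induction on the number of factors: [star_arc_prod] handles the first one, with the induction
    hypothesis for the remaining ones as its assumption on [Phi]. *)
Lemma chi_comb_foldl n (u : unitri F n) d k (mu : lsp F) :
  quasi_monomial k mu -> (k + d <= n)%N ->
  chi_comb theta n (foldl (fun D k => star_comb 1 k D) (basis mu) (iota k.+1 d)) u =
  arc_prod theta u mu * \prod_(j <- iota k.+1 d) perm_sum theta u 1 j.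
Proof.
elim: d k mu => [|d IH] k mu qm kdn /=.
  rewrite big_nil mulr1 /chi_comb /basis liftU scale1r.
  exact: chi_quasi_monomial qm.
rewrite [star_comb 1 k.+1 _]/star_comb /basis liftU scale1r big_cons mulrA.
pose Phi : {linear {freeg (lsp F) / algC} -> algC^o} :=
  HB.pack (fun D => chi_comb theta n (foldl (fun D k => star_comb 1 k D) D (iota k.+2 d)) u)
    (GRing.isLinear.Build _ _ _ _ _ (chi_comb_foldl_linear u (iota k.+2 d))).
apply: (@star_arc_prod F theta htheta n u Phi _ k.+1).
- by rewrite (leq_trans _ kdn) // addnS ltnS leq_addr.
- by move=> la qla; apply: IH; rewrite // addSnnS.
- case: (qm) => h1 h2 h3; split=> // i j /h1 /and3P[-> -> jk].
  exact: leq_trans (leqnSn k).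
- by [].
- by rewrite leqnn.
move=> j; apply/eqP/negP => /negP lj; case: qm => /(_ _ _ lj) /and3P[_ _].
by rewrite ltnn.
Qed.

(** Parts are disjoint, so arcs sharing a left or a right endpoint lie in one part, where an element
    has only one successor and one predecessor. *)
Lemma labeled_set_partition_quasi_monomial m (mu : lsp F) :
  is_labeled_set_partition [fset i in iota 1 m]%fset mu -> quasi_monomial m mu.
Proof.
case=> _ [P [[_ /trivIfsetP tP cP] arcP]].
have same B B' i : B \in P -> B' \in P -> i \in B -> i \in B' -> B = B'.
  move=> PB PB' iB iB'; apply/eqP/negP => /negP ne.
  by have /fdisjointP/(_ i iB) := tP _ _ PB PB' ne; rewrite iB'.
split.
- move=> i j /arcP[B [PB iB jB ij _]].
  have sub a : a \in B -> (0 < a <= m)%N.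
    move=> aB; have : a \in fcover P by apply/bigfcupP; exists B; rewrite ?PB.
    by rewrite cP !inE /= mem_iota add1n ltnS.
  by have /andP[-> _] := sub _ iB; have /andP[_ ->] := sub _ jB; rewrite ij.
- move=> i j j' /arcP[B [PB iB jB ij cB]] /arcP[B' [PB' iB' jB' ij' cB']].
  have e := same _ _ _ PB PB' iB iB'; subst B'.
  have := cB _ jB'; have := cB' _ jB; rewrite ij ij' /= -!leqNgt => h1 h2.
  by apply/eqP; rewrite eqn_leq h1 h2.
- move=> i i' j /arcP[B [PB iB jB ij cB]] /arcP[B' [PB' iB' jB' ij' cB']].
  have e := same _ _ _ PB PB' jB jB'; subst B'.
  have := cB _ iB'; have := cB' _ iB; rewrite ij ij' !andbT -!leqNgt => h1 h2.
  by apply/eqP; rewrite eqn_leq h1 h2.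
Qed.

End Branching.

Theorem corollary4p2 (F : finFieldType) (theta : F -> algC)
    (htheta : nontrivial_add_char theta) (m n : nat) (hm : (1 <= m)%N) (hmn : (m < n)%N)
    (mu : lsp F) (hmu : is_labeled_set_partition [fset i in iota 1 m]%fset mu) :
  Ind_unitri (ltnW hmn) (chi theta m mu) =
  chi_comb theta n
    (foldl (fun D k => star_comb 1 k D) (basis mu) (iota m.+1 (n - m))).
Proof.
have qm := labeled_set_partition_quasi_monomial hmu.
apply/cfunP => u; rewrite Ind_unitri_chi // chi_comb_foldl // ?subnKC ?(ltnW hmn) //.
(* Columns [k] with [m <= k < n], counted from 0, are the factors [m.+1] to [n], counted from 1. *)
congr (_ * _); rewrite -(subSS m n) -/(index_iota m.+1 n.+1) big_add1.
by rewrite big_geq_mkord.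
Qed.
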